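(* Let $n>k>0$. There exist real numbers $t_1,t_2,\ldots,t_{k(n-k)}$ such that there are exactly $d(k,n)$ complex $k$-dimensional subspaces $K\subset\mathbb{C}^n$ satisfying $K\cap F_{n-k}(t_i)\ne\{0\}$ for all $i=1,\ldots,k(n-k)$, and all of them are real. Equivalently, with $\alpha=(1,2,\ldots,k-1,k+1)$, the intersection $X_\alpha F_\bullet(t_1)\cap\cdots\cap X_\alpha F_\bullet(t_{k(n-k)})$ in $\mathrm{Gr}(k,n)$ is transverse with all points real.
   Context: For $t\in\mathbb{C}$, $F_i(t)$ is the row space of the $i\times n$ matrix whose $(a,b)$ entry is $\binom{b-1}{a-1}t^{b-a}$ (zero when $b<a$); equivalently $F_i(t)$ is the $i$-plane osculating the rational normal curve $\gamma(t)=(1,t,t^2,\ldots,t^{n-1})$ at $\gamma(t)$, spanned by $\gamma(t),\gamma'(t),\ldots,\gamma^{(i-1)}(t)$, and $F_\bullet(t)$ is the flag $F_1(t)\subset\cdots\subset F_n(t)$. For a flag $F_\bullet$ and $\alpha\in\binom{[n]}{k}$, $X_\alpha F_\bullet=\{K\in\mathrm{Gr}(k,n): \dim(K\cap F_{n+1-\alpha_j})\ge k+1-j,\ j=1,\ldots,k\}$; for $\alpha=(1,\ldots,k-1,k+1)$ this is $\{K: K\cap F_{n-k}\ne\{0\}\}$. $d(k,n)=\dfrac{1!\,2!\cdots(k-1)!\,[k(n-k)]!}{(n-k)!\,(n-k+1)!\cdots(n-1)!}$ is the degree of $\mathrm{Gr}(k,n)$ in its Plücker embedding. *)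

(* Defs.v *)
From Stdlib Require Import Rdefinitions.
From HB Require Import structures.
From mathcomp Require Import all_boot all_algebra.
From mathcomp Require Import complex.
From mathcomp Require Import Rstruct.
Set Implicit Arguments. Unset Strict Implicit. Unset Printing Implicit Defensive.
Import GRing.Theory Num.Theory.
Local Open Scope ring_scope.

Definition Cx : Type := complex R.

(* The i x n matrix with (a,b) entry binom(b-1,a-1) t^(b-a) (1-indexed),
   i.e. binom(b,a) t^(b-a) with 0-indexed a,b, and 0 when b < a. *)
Definition osc_mx (n i : nat) (t : Cx) : 'M[Cx]_(i, n) :=
  \matrix_(a < i, b < n)
     (if (a <= b)%N then ('C(b, a))%:R * t ^+ (b - a) else 0).

Definition osc_flag (n i : nat) (t : Cx) : {vspace 'rV[Cx]_n} :=
  <<[seq row a (osc_mx n i t) | a : 'I_i]>>%VS.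

Definition cplx_row (n : nat) (v : 'rV[R]_n) : 'rV[Cx]_n :=
  map_mx (fun x : R => (x%:C)%C) v.

Definition real_subspace (n : nat) (K : {vspace 'rV[Cx]_n}) : Prop :=
  exists X : seq 'rV[R]_n, K = <<map (@cplx_row n) X>>%VS.

(* d(k,n) = 1!2!...(k-1)! (k(n-k))! / ((n-k)!(n-k+1)!...(n-1)!),
   the degree of Gr(k,n) (an integer, so the division is exact). *)
Definition dGr (k n : nat) : nat :=
  ((\prod_(i < k) i`!) * (k * (n - k))`!) %/ (\prod_(i < k) (n - k + i)`!).

(* Main.v *)
(* Read a k-plane K in C^n as a space of polynomials of degree < n; by apolarity,
   K meets F_(n-k)(t) iff the Wronskian of K vanishes at t.  A k-plane whose
   echelon basis has degrees d_1 < ... < d_k has Wronskian of degree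
   |d| = sum d_i - k(k-1)/2, with leading coefficient a nonzero multiple of
   det (d_i^(falling j)).

   Roots t_1, ..., t_m are added one at a time, keeping the following for every d
   with |d| = m: the planes of type d whose Wronskian has the m prescribed roots
   are all real, nondegenerate, and m! det (d_i^(falling j)) / prod d_i! in number.
   When a further root t = q is sent to infinity, every solution of type d
   converges to a solution of type d - e_i for some i, and each of the latter
   deforms to exactly one solution of type d.  Existence of the deformation
   comes from minimising |E|^2 over a polydisc, uniqueness from a factorisation
   E(x) - E(y) = (x - y) Q(x, y) with Q invertible at the limit, and uniqueness
   forces the deformed solution to be fixed by complex conjugation.  The numbers
   add up since sum_i d_i det(d - e_i) = |d| det(d).

   All limits q -> oo are taken along one nonprincipal ultrafilter U, so that
   every bounded sequence converges. *)
Require Import Defs.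
From Stdlib Require Import Rdefinitions.
From HB Require Import structures.
From mathcomp Require Import all_boot all_order all_fingroup all_algebra zify ring lra.
From mathcomp Require Import boolp classical_sets filter reals topology normedtype.
From mathcomp Require Import complex.
From mathcomp Require Import Rstruct.
Set Implicit Arguments. Unset Strict Implicit. Unset Printing Implicit Defensive.
Import Order.TTheory GRing.Theory Num.Theory numFieldNormedType.Exports.
Local Open Scope ring_scope.

(** * Determinants of falling factorials *)

Section FallingFactorialDeterminant.
Variable R : comNzRingType.

(** No intersection theory enters: compactness shows that no solution is missed, and the number
    satisfies the recursion that removes one box from the partition [d i - i]. The induction has to
    run over all types, although only the top type [d i = n - k + i] is wanted, because an escaping
    root lowers the type. Nondegeneracy is carried along because it makes the Jacobian invertible at
    the limit, which both existence and uniqueness of the deformation require. A plane meeting all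
    k(n-k) conditions has the top type automatically: its Wronskian is nonzero and cannot have more
    distinct roots than its degree. The ultrafilter takes the place of subsequences: of any property
    of q and its negation, one holds for almost all q. The roots found are positive integers [q.+1],
    hence real and fixed by conjugation. *)

Definition falling_det k (d : 'I_k -> nat) : R :=
  \det (\matrix_(i < k, j < k) ((d i) ^_ j)%:R).

(** Holds term by term in the Leibniz expansion: since [x * (x-1)^_j = (x - j) * x^_j], lowering
    each entry in turn multiplies the term of [s] by the sum of all [d i - s i], which does not
    depend on [s]. The second summand on the left avoids a subtraction; when [d i = 0] the truncated
    predecessor is harmless because of the factor [d i]. *)
Lemma falling_det_pred_sum k (d : 'I_k -> nat) :
  \sum_i (d i)%:R * falling_det (fun l => if l == i then (d i).-1 else d l)
    + (\sum_(i < k) i)%:R * falling_det d = (\sum_i d i)%:R * falling_det d.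
Proof.
have step (x j : nat) : (x * x.-1 ^_ j + j * x ^_ j = x * x ^_ j)%N.
  rewrite -ffactnS ffactnSr mulnC -mulnDl.
  case: (leqP j x) => [jx|xj]; first by rewrite subnK.
  by rewrite ffact_small ?muln0.
rewrite /falling_det big_distrr /=.
under eq_bigr do rewrite big_distrr /=.
rewrite exchange_big big_distrr -big_split /=; apply: eq_bigr => s _.
have -> : (\sum_(i < k) i = \sum_(i < k) (s i : nat))%N.
  by rewrite (reindex_inj (@perm_inj _ s)).
rewrite !natr_sum !mulr_suml -big_split /=; apply: eq_bigr => i _.
rewrite !(mulrCA _ ((-1) ^+ s)) -mulrDr; congr (_ * _).
rewrite (bigD1 i) //= [in X in _ + X](bigD1 i) //= [in RHS](bigD1 i) //= !mxE eqxx !mulrA -!natrM.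
rewrite [X in _ * X + _](eq_bigr (fun l => (\matrix_(i < k, j < k) (d i ^_ j)%:R) l (s l))).
  by rewrite -mulrDl -natrD step.
by move=> l /negPf li; rewrite !mxE li.
Qed.

(** Falling factorials are the values of monic polynomials [ff j] of degree [j], so the matrix is a
    Vandermonde matrix times a unitriangular one. *)
Lemma falling_det_vandermonde k (d : 'I_k -> nat) :
  falling_det d = \prod_(i < k) \prod_(j < k | (i < j)%N) ((d j)%:R - (d i)%:R).
Proof.
pose ff j : {poly R} := \prod_(0 <= l < j) ('X - l%:R%:P).
have szff j : size (ff j) = j.+1.
  by rewrite /ff size_prod_XsubC size_iota subn0.
have mff j : ff j \is monic by rewrite monic_prod_XsubC.
have evff j x : (ff j).[x%:R] = (x ^_ j)%:R.
  elim: j => [|j IH]; first by rewrite /ff big_geq // hornerC ffactn0.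
  rewrite /ff big_nat_recr //= hornerM -/(ff j) IH hornerXsubC ffactnSr natrM.
  case: (leqP j x) => [jx|xj]; first by rewrite natrB.
  by rewrite ffact_small ?mul0r.
pose U := \matrix_(j < k, l < k) (ff j)`_l.
pose a := \row_(j < k) (d j)%:R : 'rV[R]_k.
have -> : falling_det d = \det ((Vandermonde k a)^T *m U^T).
  rewrite /falling_det; congr (\det _); apply/matrixP => i j; rewrite !mxE -evff.
  rewrite (@horner_coef_wide _ k) ?szff //; apply: eq_bigr => l _.
  by rewrite !mxE mulrC.
rewrite det_mulmx !det_tr det_Vandermonde.
have -> : \det U = 1.
  rewrite det_trig; last by apply/is_trig_mxP => i j ij; rewrite mxE nth_default ?szff.
  apply: big1 => i _; rewrite mxE.
  by have /monicP := mff i; rewrite /lead_coef szff.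
rewrite mulr1; apply: eq_bigr => i _; apply: eq_bigr => j _; by rewrite !mxE.
Qed.

Lemma falling_det_id k : falling_det (fun i : 'I_k => i : nat) = \prod_(i < k) (i`!)%:R.
Proof.
rewrite /falling_det det_trig; last first.
  by apply/is_trig_mxP => i j ij; rewrite mxE ffact_small.
by apply: eq_bigr => i _; rewrite mxE ffactnn.
Qed.

(** The Vandermonde product depends on differences only. With [c = n - k] this is the top type, and
    it yields the product of factorials in the numerator of [dGr]. *)
Lemma falling_det_shift k c : falling_det (fun i : 'I_k => c + i)%N = \prod_(i < k) (i`!)%:R.
Proof.
rewrite -falling_det_id !falling_det_vandermonde.
by apply: eq_bigr => i _; apply: eq_bigr => j _; rewrite !natrD opprD addrACA subrr add0r.
Qed.

Lemma falling_det_eq0 k (d : 'I_k -> nat) (i j : 'I_k) :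
  i != j -> d i = d j -> falling_det d = 0.
Proof. by move=> ij dij; apply: (determinant_alternate ij) => l; rewrite !mxE dij. Qed.

End FallingFactorialDeterminant.

Lemma falling_det_neq0 (F : numDomainType) k (d : 'I_k -> nat) :
  injective d -> falling_det F d != 0.
Proof.
move=> dinj; rewrite falling_det_vandermonde.
apply/prodf_neq0 => i _; apply/prodf_neq0 => j ij.
by rewrite subr_eq0 eqr_nat; apply: contraTneq ij => /dinj ->; rewrite ltnn.
Qed.

Section CoefProd.
Variable R : nzSemiRingType.

Lemma coefM_top (p q : {poly R}) a b : (size p <= a.+1)%N -> (size q <= b.+1)%N ->
  (p * q)`_(a + b) = p`_a * q`_b.
Proof.
move=> sp sq; rewrite coefM.
have ab : (a < (a + b).+1)%N by rewrite ltnS leq_addr.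
rewrite (bigD1 (Ordinal ab)) //= addKn big1 ?addr0 // => -[l /= lab] /eqP la.
have [la'|al] := ltnP l a; last first.
  by rewrite (nth_default _ (leq_trans sp _)) ?mul0r // ltn_neqAle al andbT; apply/eqP => E; case: la; apply: val_inj.
by rewrite [q`_ _]nth_default ?mulr0 //; apply: leq_trans sq _; rewrite /=; lia.
Qed.

Lemma coef_prod_top I (r : seq I) (p : I -> {poly R}) (e : I -> nat) :
  (forall i, size (p i) <= (e i).+1)%N ->
  (size (\prod_(i <- r) p i)%R <= (\sum_(i <- r) e i).+1)%N /\
  (\prod_(i <- r) p i)`_(\sum_(i <- r) e i) = \prod_(i <- r) (p i)`_(e i).
Proof.
move=> sp; elim: r => [|i r [IH1 IH2]].
  by rewrite !big_nil size_poly1 coef1.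
rewrite !big_cons coefM_top // IH2; split => //.
apply: leq_trans (size_polyMleq _ _) _.
by move: (sp i) IH1; lia.
Qed.

End CoefProd.

(** * Wronskians *)

Section DetQuotient.
Variable R : comNzRingType.
Variable k : nat.
Implicit Types X Y B : 'M[R]_k.

Definition mix_rows X Y (i : nat) : 'M[R]_k :=
  \matrix_(l, j) if (l < i)%N then Y l j else X l j.

(** A difference quotient of the determinant: going from [X] to [Y] one row at a time, step [i]
    changes only row [i], and the change is expanded along that row. On the diagonal it is the
    gradient of [\det]. *)
Definition det_quot X Y : 'M[R]_k :=
  \matrix_(i, j) cofactor (mix_rows X Y i) i j.

Lemma cofactor_eq_off_row X Y (i j : 'I_k) :
  (forall l m, l != i -> X l m = Y l m) -> cofactor X i j = cofactor Y i j.
Proof.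
move=> E; rewrite /cofactor; congr (_ * \det _).
by apply/matrixP => a b; rewrite !mxE E // eq_sym neq_lift.
Qed.

Lemma det_sub_quot X Y :
  \det X - \det Y = \sum_i \sum_j (X - Y) i j * det_quot X Y i j.
Proof.
pose D i := \det (mix_rows X Y i).
have -> : \det X = D 0 by congr (\det _); apply/matrixP => l j; rewrite mxE.
have -> : \det Y = D k by congr (\det _); apply/matrixP => l j; rewrite mxE ltn_ord.
rewrite -opprB -(telescope_sumr D (leq0n k)) -sumrN big_mkord.
apply: eq_bigr => i _; rewrite opprB /D.
have same : forall l m, l != i -> mix_rows X Y i l m = mix_rows X Y i.+1 l m.
  move=> l m li; rewrite !mxE.
  by have -> : (l < i.+1)%N = (l < i)%N by rewrite ltnS leq_eqVlt val_eqE (negPf li).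
rewrite !(expand_det_row _ i) -sumrB; apply: eq_bigr => j _.
by rewrite -(cofactor_eq_off_row j same) -mulrBl !mxE ltnn leqnn.
Qed.

Lemma det_quot_diag X : det_quot X X = \matrix_(i, j) cofactor X i j.
Proof.
apply/matrixP => i j; rewrite !mxE; apply: cofactor_eq_off_row => l m _.
by rewrite mxE if_same.
Qed.

End DetQuotient.

Section Wronskian.
Variable F : fieldType.
Variables k n : nat.
Implicit Types (A B : 'M[F]_(k, n)) (d : 'I_k -> 'I_n).

(* Rows of A are coefficient vectors of polynomials f_i of degree < n, and wr A is their Wronskian. *)
Definition wr_mx : 'M[{poly F}]_(n, k) := \matrix_(b, j) ('X^(b - j) *+ b ^_ j).

Definition lift_wr A : 'M[{poly F}]_k := map_mx polyC A *m wr_mx.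

Definition wr A : {poly F} := \det (lift_wr A).

Definition wr_quot A A' : 'M[{poly F}]_(k, n) :=
  det_quot (lift_wr A) (lift_wr A') *m wr_mx^T.

(** The derivative of [wr] at [A] in the direction [B], obtained as the diagonal of the difference
    quotient. *)
Definition dwr A B : {poly F} := \sum_i \sum_b B i b *: wr_quot A A i b.

Definition supp_le d A := forall i (b : 'I_n), (d i < b)%N -> A i b = 0.

Definition increasing d := forall i j : 'I_k, (i < j)%N -> (d i < d j)%N.

(** Row [i] is a polynomial of degree exactly [d i]. Nothing else is normalised, so a plane has many
    matrices of its type and solutions are compared through their row spaces. *)
Definition has_type d A := supp_le d A /\ forall i, A i (d i) != 0.

Lemma wr_quot_pair A A' B :
  \sum_i \sum_j lift_wr B i j * det_quot (lift_wr A) (lift_wr A') i j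
  = \sum_i \sum_b B i b *: wr_quot A A' i b.
Proof.
apply: eq_bigr => i _.
under eq_bigr do rewrite mxE big_distrl /=.
rewrite exchange_big; apply: eq_bigr => b _.
rewrite [X in _ *: X]mxE scaler_sumr; apply: eq_bigr => j _.
by rewrite !mxE -mul_polyC -mulrA; congr (_ * _); rewrite mulrC.
Qed.

Lemma lift_wrB A A' : lift_wr (A - A') = lift_wr A - lift_wr A'.
Proof. by rewrite /lift_wr map_mxB mulmxBl. Qed.

Lemma wr_sub_quot A A' :
  wr A - wr A' = \sum_i \sum_b (A - A') i b *: wr_quot A A' i b.
Proof. by rewrite /wr det_sub_quot -lift_wrB wr_quot_pair. Qed.

Lemma lift_wrM (L : 'M[F]_k) A : lift_wr (L *m A) = map_mx polyC L *m lift_wr A.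
Proof. by rewrite /lift_wr map_mxM mulmxA. Qed.

Lemma wr_mulmx (L : 'M[F]_k) A : wr (L *m A) = \det L *: wr A.
Proof. by rewrite /wr lift_wrM det_mulmx det_map_mx mul_polyC. Qed.

Lemma dwr_adj A B : dwr A B = \tr (lift_wr B *m \adj (lift_wr A)).
Proof.
rewrite /dwr -wr_quot_pair det_quot_diag /mxtrace; apply: eq_bigr => i _.
by rewrite mxE; apply: eq_bigr => j _; rewrite !mxE.
Qed.

(** A change of basis only rescales the Wronskian. Directions inside the row space are therefore
    invisible at the roots of [wr A], which is why nondegeneracy is stated modulo that row space. *)
Lemma dwr_mulmx (L : 'M[F]_k) A : dwr A (L *m A) = \tr L *: wr A.
Proof.
rewrite dwr_adj lift_wrM -mulmxA mul_mx_adj -/(wr A) mul_mx_scalar linearZ /=.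
by rewrite trace_map_mx mulrC mul_polyC.
Qed.

Lemma dwrB A B B' : dwr A (B - B') = dwr A B - dwr A B'.
Proof. by rewrite !dwr_adj lift_wrB mulmxBl linearB. Qed.

Definition set_row A i (v : 'rV[F]_n) : 'M[F]_(k, n) :=
  \matrix_(l, b) if l == i then v 0 b else A l b.

Lemma dwr_rows A B : dwr A B = \sum_i wr (set_row A i (row i B)).
Proof.
rewrite /dwr -wr_quot_pair det_quot_diag; apply: eq_bigr => i _.
rewrite /wr (expand_det_row _ i); apply: eq_bigr => j _.
rewrite [X in _ * X]mxE; congr (_ * _).
  by rewrite !mxE; apply: eq_bigr => b _; rewrite !mxE eqxx.
apply: cofactor_eq_off_row => l m /negPf li; rewrite !mxE.
by apply: eq_bigr => b _; rewrite !mxE li.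
Qed.

(** Multiplying column [j] by ['X^j] undoes the loss of degree in the [j]-th derivative. All entries
    of row [i] then share one degree bound, and every Leibniz term has the same top degree. *)
Lemma wr_shift A : 'X^(\sum_(i < k) i) * wr A =
  \det (\matrix_(i < k, j < k) \sum_b (A i b * (b ^_ j)%:R) *: 'X^b).
Proof.
have -> : 'X^(\sum_(i < k) i) = \det (diag_mx (\row_(j < k) ('X^j : {poly F}))).
  rewrite det_diag; under [RHS]eq_bigr do rewrite mxE.
  by rewrite -expr_sum.
rewrite mulrC /wr -det_mulmx mul_mx_diag; congr (\det _); apply/matrixP => i j.
rewrite !mxE big_distrl /=; apply: eq_bigr => b _; rewrite !mxE -mulrA.
have -> : ('X^(b - j) *+ b ^_ j) * 'X^j = 'X^b *+ b ^_ j :> {poly F}.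
  case: (leqP j b) => jb; first by rewrite mulrnAl -exprD subnK.
  by rewrite ffact_small ?mulr0n ?mul0r.
by rewrite -scalerA mul_polyC scaler_nat.
Qed.

Lemma wr_top d A m : supp_le d A -> (\sum_i d i = m + \sum_(i < k) i)%N ->
  (size (wr A) <= m.+1)%N /\
  (wr A)`_m = falling_det F (fun i => d i) * \prod_i A i (d i).
Proof.
move=> sA dm; pose q i j := \sum_b (A i b * (b ^_ j)%:R) *: ('X^b : {poly F}).
have szq i (j : nat) : (size (q i j) <= (d i).+1)%N.
  apply/leq_sizeP => l dl; rewrite coef_sum big1 // => b _; rewrite coefZ coefXn.
  case: eqP => [lb|_]; last by rewrite mulr0.
  by rewrite sA ?mul0r // -lb.
have tq i (j : nat) : (q i j)`_(d i) = A i (d i) * (d i ^_ j)%:R.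
  rewrite coef_sum (bigD1 (d i)) //= coefZ coefXn eqxx mulr1 big1 ?addr0 // => b bd.
  by rewrite coefZ coefXn eq_sym val_eqE (negPf bd) mulr0.
have E := wr_shift A.
have coefE l : (wr A)`_l = ('X^(\sum_(i < k) i) * wr A)`_(l + \sum_(i < k) i).
  by rewrite coefXnM ltnNge leq_addl /= addnK.
have detE : 'X^(\sum_(i < k) i) * wr A = \sum_(s : 'S_k) (-1) ^+ s * \prod_i q i (s i).
  by rewrite E; apply: eq_bigr => s _; congr (_ * _); apply: eq_bigr => i _; rewrite mxE.
have prodq (s : 'S_k) := @coef_prod_top _ _ (index_enum 'I_k) (fun i => q i (s i))
  (fun i => d i) (fun i => szq i (s i)).
split.
  apply/leq_sizeP => l ml; rewrite coefE detE coef_sum big1 // => s _.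
  have [sz _] := prodq s.
  rewrite -signr_odd; case: odd; rewrite ?mulN1r ?mul1r ?coefN nth_default ?oppr0 //;
    by apply: leq_trans sz _; rewrite dm ltn_add2r.
rewrite coefE -dm detE coef_sum /falling_det /determinant big_distrl /=.
apply: eq_bigr => s _; have [_ tp] := prodq s.
rewrite -(rmorph_sign (@polyC F)) coefCM tp -mulrA -big_split /=; congr (_ * _).
by apply: eq_bigr => i _; rewrite tq mxE mulrC.
Qed.

(** In the product rule, every term except the one replacing row [i] keeps the factor
    [A i (d i) = 0]. It is applied at a plane of lower type, whose corner entry vanishes. *)
Lemma dwr_top d A B m i : supp_le d A -> supp_le d B ->
  (\sum_i d i = m + \sum_(i < k) i)%N -> A i (d i) = 0 ->
  (dwr A B)`_m =
    falling_det F (fun i => d i) * (B i (d i) * \prod_(j | j != i) A j (d j)).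
Proof.
move=> sA sB dm Ai; rewrite dwr_rows coef_sum.
have supp l : supp_le d (set_row A l (row l B)).
  by move=> a b ab; rewrite !mxE; case: eqP => [<-|_]; [apply: sB|apply: sA].
rewrite (bigD1 i) //= big1 => [|l li].
  rewrite (wr_top (supp i) dm).2 addr0; congr (_ * _).
  rewrite (bigD1 i) //= !mxE eqxx; congr (_ * _).
  by apply: eq_bigr => j /negPf ji; rewrite !mxE ji.
rewrite (wr_top (supp l) dm).2 (bigD1 i) //= !mxE eq_sym (negPf li) Ai.
by rewrite mul0r mulr0.
Qed.

End Wronskian.

(** * Echelon types *)

Lemma exists_sorting_perm k n (d : 'I_k -> 'I_n) : injective d ->
  exists s : 'S_k, increasing (d \o s).
Proof.
move=> dinj; pose t := [tuple d i : nat | i < k].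
have [s st] : exists s : 'S_k, sort leq t = [tuple tnth t (s i) | i < k].
  by apply/tuple_permP; rewrite perm_sort.
exists s => i j ij; rewrite ltn_neqAle; apply/andP; split.
  by apply: contraTneq ij => /val_inj/dinj/perm_inj ->; rewrite ltnn.
have nthE (a : 'I_k) : nth 0%N (sort leq t) a = d (s a).
  by rewrite st -tnth_nth !tnth_mktuple.
rewrite /= -!nthE; apply: (sorted_leq_nth leq_trans leqnn).
- exact: sort_sorted leq_total _.
- by rewrite inE size_sort size_tuple.
- by rewrite inE size_sort size_tuple.
exact: ltnW.
Qed.

Section EchelonTypes.
Variable F : fieldType.
Variables k n : nat.
Implicit Types (A B : 'M[F]_(k, n)) (d : 'I_k -> 'I_n).

Definition set_at d i b : 'I_k -> 'I_n := fun l => if l == i then b else d l.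

Lemma colsub_mulmx d (G : 'M[F]_k) A : colsub d (G *m A) = G *m colsub d A.
Proof. by apply/matrixP => i j; rewrite !mxE; apply: eq_bigr => l _; rewrite mxE. Qed.

Lemma det_colsub_set d A i b : colsub d A = 1%:M -> \det (colsub (set_at d i b) A) = A i b.
Proof.
move=> Ad; rewrite (expand_det_col _ i) (bigD1 i) //= !mxE /set_at eqxx.
have cof a : cofactor (colsub (set_at d i b) A) a i = (i == a)%:R.
  have -> : cofactor (colsub (set_at d i b) A) a i = cofactor (colsub d A) a i.
    rewrite /cofactor; congr (_ * \det _); apply/matrixP => x y; rewrite !mxE /set_at.
    by rewrite eq_sym (negPf (neq_lift _ _)).
  by rewrite Ad; move/matrixP/(_ i a): (adj1 F k); rewrite !mxE.
rewrite cof eqxx mulr1 big1 ?addr0 // => a ai.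
by rewrite cof eq_sym (negPf ai) mulr0.
Qed.

Lemma colsub_normalized d A : colsub d A \in unitmx -> colsub d (invmx (colsub d A) *m A) = 1%:M.
Proof. by move=> u; rewrite colsub_mulmx mulVmx. Qed.

Lemma normalized_entry d A i b : colsub d A \in unitmx ->
  (invmx (colsub d A) *m A) i b = \det (colsub (set_at d i b) A) / \det (colsub d A).
Proof.
move=> u; rewrite -(@det_colsub_set d) ?colsub_normalized //.
by rewrite colsub_mulmx det_mulmx det_inv mulrC.
Qed.

Lemma rank_colsub_unit A : \rank A = k -> exists d, colsub d A \in unitmx.
Proof.
move=> rk.
have [f] : exists f : 'I_n ^ (\rank A^T), row_free (rowsub f A^T).
  by exists (maxrankfun A^T); apply: maxrowsub_free.
move: f; rewrite mxrank_tr rk => f; rewrite row_free_unit => fu.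
exists f; rewrite -unitmx_tr; congr (_ \in unitmx): fu.
by apply/matrixP => i j; rewrite !mxE.
Qed.

Lemma colsub_unit_rank d A : colsub d A \in unitmx -> \rank A = k.
Proof.
move=> u; apply/eqP; rewrite eqn_leq rank_leq_row /= -{1}(mxrank_unit u).
have -> : colsub d A = A *m colsub d 1%:M.
  apply/matrixP => i j; rewrite !mxE (bigD1 (d j)) //= !mxE eqxx mulr1 big1 ?addr0 //.
  by move=> l /negPf lj; rewrite !mxE lj mulr0.
exact: mxrankM_maxl.
Qed.

Lemma colsub_unit_inj d A : colsub d A \in unitmx -> injective d.
Proof.
rewrite unitmxE unitfE => /eqP u i j dij; apply/eqP; apply: contra_notT u => ij.
by rewrite -det_tr; apply: (determinant_alternate ij) => l; rewrite !mxE dij.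
Qed.

(* Gaussian elimination: a column selection with nonzero minor and maximal sum of indices is the pivot set. *)
Lemma exists_type A : \rank A = k ->
  exists d, increasing d /\ exists2 G : 'M[F]_k, G \in unitmx & has_type d (G *m A).
Proof.
case/rank_colsub_unit => d0 d0u.
pose P (e : {ffun 'I_k -> 'I_n}) := colsub e A \in unitmx.
have P0 : P [ffun i => d0 i].
  rewrite /P; congr (_ \in unitmx): d0u.
  by apply/matrixP => i j; rewrite !mxE ffunE.
case: (@arg_maxnP _ _ P (fun e : {ffun 'I_k -> 'I_n} => \sum_i e i)%N P0) => d Pd dmax.
have inj := colsub_unit_inj Pd.
have [s sinc] := exists_sorting_perm inj.
exists (d \o s); split => //.
set B := invmx (colsub d A) *m A.
have Bd : colsub d B = 1%:M by apply: colsub_normalized.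
exists (perm_mx s *m invmx (colsub d A)).
  by rewrite unitmx_mul unitmx_perm unitmx_inv.
rewrite -mulmxA -/B -row_permE; split => [i b ib|i]; last first.
  rewrite mxE /=; move/matrixP/(_ (s i) (s i)): Bd; rewrite !mxE eqxx => ->.
  exact: oner_neq0.
rewrite mxE; apply/eqP; apply: contraTT ib => Bib; rewrite -leqNgt /=.
pose e : {ffun 'I_k -> 'I_n} := [ffun l => set_at d (s i) b l].
have Pe : P e.
  rewrite /P; have -> : colsub e A = colsub (set_at d (s i) b) A.
    by apply/matrixP => x y; rewrite !mxE ffunE.
  have -> : A = colsub d A *m B by rewrite mulKVmx.
  rewrite colsub_mulmx unitmx_mul; apply/andP; split; first exact: Pd.
  by rewrite unitmxE unitfE det_colsub_set.
have le : (\sum_i e i <= \sum_i d i)%N := dmax e Pe.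
move: le; rewrite (bigD1 (s i)) //= [X in (_ <= X)%N](bigD1 (s i)) //=.
rewrite ffunE /set_at eqxx (eq_bigr (fun j => d j : nat)) ?leq_add2r //.
by move=> j /negPf ji; rewrite ffunE /set_at ji.
Qed.

Lemma trig_supp d d' B : (forall i j : 'I_k, (i < j)%N -> (d' i < d j)%N) ->
  supp_le d' B -> is_trig_mx (colsub d B).
Proof. by move=> dd sB; apply/is_trig_mxP => i j ij; rewrite mxE; apply/sB/dd. Qed.

Lemma invmx_trig (L : 'M[F]_k) : is_trig_mx L -> L \in unitmx -> is_trig_mx (invmx L).
Proof.
move=> /is_trig_mxP tL uL; apply/is_trig_mxP => i j ij.
have diag l : L l l != 0.
  have : \prod_l L l l != 0 by rewrite -det_trig -?unitfE -?unitmxE //; apply/is_trig_mxP.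
  by move/prodf_neq0/(_ l isT).
apply/eqP; apply: contraT => nz.
(* With [m] the last nonzero column of row [i] of the inverse, the entry [(i, m)] of [invmx L *m L]
   is the single nonzero product [invmx L i m * L m m], although [i < m]. *)
case: (@arg_maxnP _ j (fun l : 'I_k => invmx L i l != 0) (fun l => l) nz) => m nzm mmax.
have im : (i < m)%N by apply: leq_trans ij (mmax j nz).
have /matrixP/(_ i m) := mulVmx uL; rewrite !mxE (bigD1 m) //= big1 => [|l lm].
  rewrite addr0 => /eqP; have -> : (i == m) = false by apply: contraTF im => /eqP ->; rewrite ltnn.
  by rewrite mulf_eq0 (negPf nzm) (negPf (diag m)).
have [ml|ml] := ltnP l m; first by rewrite (tL l m) ?mulr0.
have [->|nzl] := eqVneq (invmx L i l) 0; first by rewrite mul0r.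
by case/eqP: lm; apply: val_inj; apply/eqP; rewrite eqn_leq ml andbT; apply: mmax.
Qed.

Lemma mulmx_trig (L L' : 'M[F]_k) : is_trig_mx L -> is_trig_mx L' -> is_trig_mx (L *m L').
Proof.
move=> /is_trig_mxP tL /is_trig_mxP tL'; apply/is_trig_mxP => i j ij.
rewrite mxE big1 // => l _; have [il|li] := ltnP i l; first by rewrite tL ?mul0r.
by rewrite tL' ?mulr0 //; apply: leq_ltn_trans ij.
Qed.

Lemma supp_le_mulmx d (L : 'M[F]_k) B : increasing d -> is_trig_mx L ->
  supp_le d B -> supp_le d (L *m B).
Proof.
move=> inc /is_trig_mxP tL sB i b ib; rewrite mxE big1 // => l _.
have [il|li] := ltnP i l; first by rewrite tL ?mul0r.
rewrite sB ?mulr0 //; apply: leq_ltn_trans ib.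
by move: li; rewrite leq_eqVlt => /orP[/eqP/val_inj -> //|/inc/ltnW].
Qed.

Lemma type_colsub_unit d B : increasing d -> has_type d B -> colsub d B \in unitmx.
Proof.
move=> inc [sB nz]; rewrite unitmxE unitfE det_trig; last exact: trig_supp sB.
by apply/prodf_neq0 => i _; rewrite mxE.
Qed.

Lemma increasing_inj d : increasing d -> injective d.
Proof.
move=> inc i j dij; apply: val_inj; apply/eqP; case: ltngtP => // /inc;
by rewrite dij ltnn.
Qed.

(** A nonzero minor has a nonzero Leibniz term. The resulting inequality does not mention [B], so it
    survives limits in which the support of the matrix is lost. *)
Lemma minor_dominated d d' B : supp_le d' B -> colsub d B \in unitmx ->
  exists s : 'S_k, forall j, (d (s j) <= d' j)%N.
Proof.
move=> sB; rewrite unitmxE unitfE => nz.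
case: (pickP (fun s : 'S_k => [forall j, (d (s j) <= d' j)%N])) => [s /forallP|none].
  by exists s.
case/eqP: nz; rewrite /determinant big1 // => s _.
have /negbT/forallPn [j] := none s; rewrite -ltnNge => js.
by rewrite (bigD1 j) //= mxE sB // mul0r mulr0.
Qed.

End EchelonTypes.

(** * Limits along an ultrafilter *)

Definition ultra_complete (C : numClosedFieldType) (U : set_system nat) : Prop :=
  forall (u : nat -> C) (M : C), (forall m, `|u m| <= M) -> exists l : C, (u @ U --> l)%classic.

(** The order of [C] is partial and [0 <= x] makes [x] real, so this is the infimum of a nonempty
    set of nonnegative reals, stated inside [C]. *)
Definition has_approx_min (C : numClosedFieldType) : Prop :=
  forall P : C -> Prop, (exists x, P x) -> (forall x, P x -> 0 <= x) ->
  forall e, 0 < e -> exists2 x, P x & forall y, P y -> x <= y + e.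

Section UltrafilterLimits.
Variables (C : numClosedFieldType) (U : set_system nat).
Context {ultraU : UltraFilter U}.

Definition ulim (u : nat -> C) (l : C) : Prop := (u @ U --> l)%classic.

Lemma ulimP u l : ulim u l <-> forall e, 0 < e -> \forall m \near U, `|u m - l| < e.
Proof.
split=> [ul e e0|H].
  have /cvgrPdist_lt/(_ e e0) := ul.
  by apply: filterS => m; rewrite distrC.
apply/cvgrPdist_lt => e e0.
by apply: filterS (H e e0) => m; rewrite distrC.
Qed.

Lemma ulim_unique u l l' : ulim u l -> ulim u l' -> l = l'.
Proof. by move=> ul ul'; apply: (@cvg_unique _ _ (u @ U)%classic) => //; exact: norm_hausdorff. Qed.

Lemma ulim_cst c : ulim (fun=> c) c.
Proof. exact: cvg_cst. Qed.

Lemma ulimD u v a b : ulim u a -> ulim v b -> ulim (fun m => u m + v m) (a + b).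
Proof. by move=> ua vb; apply: cvgD. Qed.

Lemma ulimN u a : ulim u a -> ulim (fun m => - u m) (- a).
Proof. by move=> ua; apply: cvgN. Qed.

Lemma ulimB u v a b : ulim u a -> ulim v b -> ulim (fun m => u m - v m) (a - b).
Proof. by move=> ua vb; apply: ulimD => //; apply: ulimN. Qed.

Lemma ulimM u v a b : ulim u a -> ulim v b -> ulim (fun m => u m * v m) (a * b).
Proof. by move=> ua vb; apply: cvgM. Qed.

Lemma ulim_norm u a : ulim u a -> ulim (fun m => `|u m|) `|a|.
Proof.
move/ulimP=> H; apply/ulimP => e e0; apply: filterS (H e e0) => m.
by apply: le_lt_trans; rewrite ler_dist_dist.
Qed.

Lemma ulim_conj u a : ulim u a -> ulim (fun m => (u m)^*) a^*.
Proof.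
move/ulimP=> H; apply/ulimP => e e0; apply: filterS (H e e0) => m.
by rewrite -rmorphB norm_conjC.
Qed.

Lemma ulim_near u v a : (\forall m \near U, u m = v m) -> ulim u a -> ulim v a.
Proof.
move=> uv /ulimP H; apply/ulimP => e e0.
by apply: filterS2 uv (H e e0) => m ->.
Qed.

Lemma ulimV u a : a != 0 -> ulim u a -> ulim (fun m => (u m)^-1) a^-1.
Proof. by move=> a0 ua; apply: (cvgV a0). Qed.

Lemma ulim_neq0 u a : a != 0 -> ulim u a -> \forall m \near U, u m != 0.
Proof.
move=> a0 /ulimP/(_ `|a|); rewrite normr_gt0 => /(_ a0).
by apply: filterS => m; apply: contraTneq => ->; rewrite sub0r normrN ltxx.
Qed.

Lemma ulim_ge0 u a : (\forall m \near U, 0 <= u m) -> ulim u a -> 0 <= a.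
Proof.
move=> u0 ua; apply/normr_idP; apply: (ulim_unique _ ua).
apply: ulim_near (ulim_norm ua).
by apply: filterS u0 => m /normr_idP.
Qed.

Lemma ulim_le u v a b : (\forall m \near U, u m <= v m) -> ulim u a -> ulim v b -> a <= b.
Proof.
move=> uv ua vb; rewrite -subr_ge0; apply: (ulim_ge0 _ (ulimB vb ua)).
by apply: filterS uv => m; rewrite subr_ge0.
Qed.

Lemma ulim_sum I (r : seq I) (P : pred I) (u : I -> nat -> C) (a : I -> C) :
  (forall i, ulim (u i) (a i)) ->
  ulim (fun m => \sum_(i <- r | P i) u i m) (\sum_(i <- r | P i) a i).
Proof.
move=> H; elim: r => [|i r IH].
  by rewrite big_nil; under eq_fun do rewrite big_nil; apply: ulim_cst.
rewrite big_cons; under eq_fun do rewrite big_cons.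
by case: (P i) => //; apply: ulimD.
Qed.

Lemma ulim_prod I (r : seq I) (P : pred I) (u : I -> nat -> C) (a : I -> C) :
  (forall i, ulim (u i) (a i)) ->
  ulim (fun m => \prod_(i <- r | P i) u i m) (\prod_(i <- r | P i) a i).
Proof.
move=> H; elim: r => [|i r IH].
  by rewrite big_nil; under eq_fun do rewrite big_nil; apply: ulim_cst.
rewrite big_cons; under eq_fun do rewrite big_cons.
by case: (P i) => //; apply: ulimM.
Qed.

Definition mlim p q (x : nat -> 'M[C]_(p, q)) (a : 'M[C]_(p, q)) : Prop :=
  forall i j, ulim (fun m => x m i j) (a i j).

Lemma mlim_cst p q (a : 'M[C]_(p, q)) : mlim (fun=> a) a.
Proof. by move=> i j; apply: ulim_cst. Qed.

Lemma mlim_unique p q x (a b : 'M[C]_(p, q)) : mlim x a -> mlim x b -> a = b.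
Proof. by move=> xa xb; apply/matrixP => i j; apply: ulim_unique (xa i j) (xb i j). Qed.

Lemma mlim_near p q x y (a : 'M[C]_(p, q)) :
  (\forall m \near U, x m = y m) -> mlim x a -> mlim y a.
Proof. by move=> xy xa i j; apply: ulim_near (xa i j); apply: filterS xy => m ->. Qed.

Lemma mlimM p q r x y (a : 'M[C]_(p, q)) (b : 'M[C]_(q, r)) : mlim x a -> mlim y b ->
  mlim (fun m => x m *m y m) (a *m b).
Proof.
move=> xa yb i j; rewrite !mxE; under eq_fun do rewrite !mxE.
by apply: ulim_sum => l; apply: ulimM.
Qed.

Lemma mlim_det q x (a : 'M[C]_q) : mlim x a -> ulim (fun m => \det (x m)) (\det a).
Proof.
move=> xa; apply: ulim_sum => s; apply: ulimM; first exact: ulim_cst.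
by apply: ulim_prod => i.
Qed.

Lemma mlim_colsub p q (d : 'I_p -> 'I_q) r x (a : 'M[C]_(r, q)) : mlim x a ->
  mlim (fun m => colsub d (x m)) (colsub d a).
Proof. by move=> xa i j; rewrite !mxE; under eq_fun do rewrite !mxE; apply: xa. Qed.

Lemma mlim_unit q x (a : 'M[C]_q) : a \in unitmx -> mlim x a ->
  \forall m \near U, x m \in unitmx.
Proof.
rewrite unitmxE unitfE => a0 /mlim_det/(ulim_neq0 a0).
by apply: filterS => m; rewrite unitmxE unitfE.
Qed.

Lemma mlim_inv q x (a : 'M[C]_q) : a \in unitmx -> mlim x a ->
  mlim (fun m => invmx (x m)) (invmx a).
Proof.
move=> ua xa; apply: (@mlim_near _ _ (fun m => (\det (x m))^-1 *: \adj (x m))).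
  by apply: filterS (mlim_unit ua xa) => m um; rewrite /invmx um.
rewrite /invmx ua => i j; rewrite !mxE; under eq_fun do rewrite !mxE.
apply: ulimM; first by apply: ulimV; [rewrite -unitfE -unitmxE|apply: mlim_det].
apply: ulimM; first exact: ulim_cst.
by apply: mlim_det => u v; rewrite !mxE; under eq_fun do rewrite !mxE; apply: xa.
Qed.

Hypothesis complU : ultra_complete C U.

Lemma mlim_bounded p q (x : nat -> 'M[C]_(p, q)) (M : C) :
  (forall m i j, `|x m i j| <= M) -> exists a, mlim x a.
Proof.
move=> xM; have H (ij : 'I_p * 'I_q) : exists l, ulim (fun m => x m ij.1 ij.2) l.
  exact: complU.
have [f Hf] := choice H.
by exists (\matrix_(i, j) f (i, j)) => i j; rewrite mxE; apply: (Hf (i, j)).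
Qed.

End UltrafilterLimits.

(** * Persistence of nondegenerate zeros *)

Lemma near_forall_fin (U : set_system nat) {FU : Filter U} (I : finType) (P : nat -> I -> Prop) :
  (forall i, \forall m \near U, P m i) -> \forall m \near U, forall i, P m i.
Proof.
move=> H; have : \forall m \near U, forall i, i \in enum I -> P m i.
  elim: (enum I) => [|a l IH]; first by apply: nearW.
  by apply: filterS2 (H a) IH => m Ha Hl j; rewrite inE => /orP[/eqP ->//|/Hl].
by apply: filterS => m Hm j; apply: Hm; rewrite mem_enum.
Qed.

Section ZeroPerturbation.
Variables (C : numClosedFieldType) (U : set_system nat).
Context {ultraU : UltraFilter U}.
Hypothesis complU : ultra_complete C U.
Hypothesis minC : has_approx_min C.
Hypothesis invU : ulim U (fun m => (m.+1%:R : C)^-1) 0.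

Local Notation ulimU := (@ulim C U).
Local Notation mlimU := (@mlim C U _ _).

(** A square system with a parameter, later the inverse of the moving root. [Q] is its difference
    quotient, so [Q s x x] is the Jacobian, and continuity of [Q] stands in for
    differentiability. *)
Variables (N : nat) (E : C -> 'rV[C]_N -> 'rV[C]_N).
Variable Q : C -> 'rV[C]_N -> 'rV[C]_N -> 'M[C]_N.
Hypothesis EQ : forall s x y, E s x - E s y = (x - y) *m Q s x y.
Hypothesis contE : forall s s0 x x0, ulimU s s0 -> mlimU x x0 ->
  mlimU (fun m => E (s m) (x m)) (E s0 x0).
Hypothesis contQ : forall s s0 x x0 y y0, ulimU s s0 -> mlimU x x0 -> mlimU y y0 ->
  mlimU (fun m => Q (s m) (x m) (y m)) (Q s0 x0 y0).

Variables (p : 'rV[C]_N) (s : nat -> C).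
Hypothesis s0 : ulimU s 0.
Hypothesis Qp : Q 0 p p \in unitmx.

Lemma zeros_near_unique s' x y : ulimU s' 0 -> mlimU x p -> mlimU y p ->
  (\forall m \near U, E (s' m) (x m) = E (s' m) (y m)) -> \forall m \near U, x m = y m.
Proof.
move=> s'0 xp yp EE; apply: filterS2 (mlim_unit Qp (contQ s'0 xp yp)) EE => m um Exy.
have := EQ (s' m) (x m) (y m); rewrite Exy subrr => /esym/(congr1 (mulmxr (invmx (Q (s' m) (x m) (y m))))).
by rewrite /= mulmxK // mul0mx => /eqP; rewrite subr_eq0 => /eqP.
Qed.

Definition sqnorm (f : 'rV[C]_N) : C := \sum_j `|f 0 j| ^+ 2.

Lemma sqnorm_ge0 f : 0 <= sqnorm f.
Proof. by apply: sumr_ge0 => j _; apply: exprn_ge0. Qed.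

Lemma sqnorm_le0 f : sqnorm f <= 0 -> f = 0.
Proof.
move=> le; apply/rowP => j; rewrite mxE; apply/eqP; rewrite -normr_eq0 -sqrf_eq0.
have : sqnorm f == 0 by rewrite eq_le le sqnorm_ge0.
rewrite psumr_eq0 => [/allP/(_ j)|i _]; last exact: exprn_ge0.
by rewrite mem_index_enum => /(_ isT).
Qed.

Lemma ulim_sqnorm f f0 : mlimU f f0 -> ulimU (fun m => sqnorm (f m)) (sqnorm f0).
Proof.
by move=> ff; apply: ulim_sum => j; apply: ulimM; apply: ulim_norm; apply: ff.
Qed.

Definition in_polydisc (r : C) (x : 'rV[C]_N) : Prop := forall j, `|x 0 j - p 0 j| <= r.

Lemma polydisc_lim r x x0 : (forall m, in_polydisc r (x m)) -> mlimU x x0 -> in_polydisc r x0.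
Proof.
move=> xr xx j; apply: (ulim_le (u := fun m => `|x m 0 j - p 0 j|) (v := fun=> r)).
- by apply: nearW => m; apply: xr.
- by apply: ulim_norm; apply: ulimB; [apply: xx|apply: ulim_cst].
exact: ulim_cst.
Qed.

Lemma polydisc_bounded_lim r (x : nat -> 'rV[C]_N) : (forall m, in_polydisc r (x m)) ->
  exists x0, mlimU x x0.
Proof.
move=> xr; apply: (@mlim_bounded _ _ complU _ _ _ (r + \sum_j `|p 0 j|)) => m i j.
rewrite ord1 -(subrK (p 0 j) (x m 0 j)); apply: le_trans (ler_normD _ _) _.
apply: lerD; first exact: xr.
by rewrite (bigD1 j) //= lerDl sumr_ge0.
Qed.

(** Minimisers up to an error [1/(m+1)] stay in the polydisc, so they converge along [U], and their
    limit is an exact minimiser. Here [U] only provides compactness, since the parameter is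
    fixed. *)
Lemma sqnorm_attains_min (r s' : C) : 0 <= r -> exists2 x, in_polydisc r x &
  forall y, in_polydisc r y -> sqnorm (E s' x) <= sqnorm (E s' y).
Proof.
move=> r0.
have H (m : nat) : exists x, in_polydisc r x /\ forall y, in_polydisc r y ->
    sqnorm (E s' x) <= sqnorm (E s' y) + (m.+1%:R)^-1.
  have [|||_ [x [xr <-]] H] := minC (P := fun c => exists x, in_polydisc r x /\ sqnorm (E s' x) = c) _ _ (e := (m.+1%:R)^-1).
  - by exists (sqnorm (E s' p)); exists p; split => // j; rewrite subrr normr0.
  - by move=> _ [x [_ <-]]; apply: sqnorm_ge0.
  - by rewrite invr_gt0 ltr0Sn.
  by exists x; split => // y yr; apply: H; exists y.
have [x Hx] := choice H.
have [x0 xx0] := polydisc_bounded_lim (fun m => (Hx m).1).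
exists x0; first exact: polydisc_lim (fun m => (Hx m).1) xx0.
move=> y yr; rewrite -[leRHS]addr0.
apply: (ulim_le (u := fun m => sqnorm (E s' (x m))) (v := fun m => sqnorm (E s' y) + m.+1%:R^-1)).
- by apply: nearW => m; apply: (Hx m).2.
- by apply: ulim_sqnorm; apply: contE => //; apply: ulim_cst.
by apply: ulimD => //; apply: ulim_cst.
Qed.

(* At an interior minimum the Newton direction would decrease |E|^2 to first order by 2|E|^2. *)
Lemma interior_min_zero (r s' : C) (x : 'rV[C]_N) : (forall j, `|x 0 j - p 0 j| < r) ->
  (forall y, in_polydisc r y -> sqnorm (E s' x) <= sqnorm (E s' y)) ->
  Q s' x x \in unitmx -> E s' x = 0.
Proof.
move=> xint xmin ux; apply: sqnorm_le0.
set f := E s' x; pose v := - f *m invmx (Q s' x x).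
pose h (m : nat) : C := m.+1%:R^-1.
have h0 m : 0 < h m by rewrite invr_gt0 ltr0Sn.
pose y m := x + h m *: v.
have yx : mlimU y x.
  move=> i j; rewrite -[x i j]addr0 -[X in _ + X](mul0r (v i j)).
  under eq_fun do rewrite mxE [X in _ + X]mxE.
  by apply: ulimD; [apply: ulim_cst|apply: ulimM; [exact: invU|apply: ulim_cst]].
pose w m := v *m Q s' (y m) x.
have wf : mlimU w (- f).
  rewrite -[- f](mulmxKV ux); apply: mlimM; first exact: mlim_cst.
  by apply: contQ => //; [apply: ulim_cst|apply: mlim_cst].
have Ey m : E s' (y m) = f + h m *: w m.
  have yE : y m - x = h m *: v by rewrite /y addrC addKr.
  by rewrite -[E s' (y m)](subrK f) EQ yE addrC -scalemxAl.
have yin : \forall m \near U, in_polydisc r (y m).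
  apply: near_forall_fin => j.
  have r' : 0 < r - `|x 0 j - p 0 j| by rewrite subr_gt0.
  have /ulimP/(_ _ r') := yx 0 j.
  apply: filterS => m; rewrite ltrBrDl => lt; apply: ltW; apply: le_lt_trans lt.
  have -> : y m 0 j - p 0 j = (x 0 j - p 0 j) + (y m 0 j - x 0 j) by rewrite [RHS]addrC addrA subrK.
  exact: ler_normD.
pose q m := \sum_j (f 0 j * (w m 0 j)^* + w m 0 j * (f 0 j)^* + h m * (w m 0 j * (w m 0 j)^*)).
have qE m : sqnorm (E s' (y m)) - sqnorm f = h m * q m.
  rewrite Ey /sqnorm -sumrB mulr_sumr; apply: eq_bigr => j _.
  rewrite !normCK [(f + h m *: w m) 0 j]mxE [(h m *: w m) 0 j]mxE rmorphD rmorphM /=.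
  rewrite (conj_Creal (ger0_real (ltW (h0 m)))).
  by ring.
have qlim : ulimU q (- (sqnorm f + sqnorm f)).
  have -> : - (sqnorm f + sqnorm f) =
      \sum_j (f 0 j * ((- f) 0 j)^* + (- f) 0 j * (f 0 j)^* + 0 * ((- f) 0 j * ((- f) 0 j)^*)).
    rewrite /sqnorm -big_split -sumrN /=; apply: eq_bigr => j _.
    by rewrite mul0r addr0 !normCK !mxE rmorphN mulrN mulNr opprD.
  apply: ulim_sum => j; apply: ulimD; first apply: ulimD.
  - by apply: ulimM; [apply: ulim_cst|apply: ulim_conj; apply: wf].
  - by apply: ulimM; [apply: wf|apply: ulim_cst].
  by apply: ulimM; [exact: invU|]; apply: ulimM; [apply: wf|apply: ulim_conj; apply: wf].
have : 0 <= - (sqnorm f + sqnorm f).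
  apply: ulim_ge0 qlim; apply: filterS yin => m /xmin.
  by rewrite -subr_ge0 qE pmulr_rge0.
by rewrite oppr_ge0 -mulr2n pmulrn_lle0.
Qed.

Hypothesis Ep : E 0 p = 0.

(** Otherwise there are zeros other than [p] within [1/(m+1)] of it; they converge to [p], against
    uniqueness for the constant parameter 0. *)
Lemma isolated_zero : exists2 r : C, 0 < r & forall x, in_polydisc r x -> E 0 x = 0 -> x = p.
Proof.
apply: contrapT => none.
have H (m : nat) : exists x, in_polydisc (m.+1%:R^-1) x /\ (E 0 x = 0 /\ x <> p).
  apply: contrapT => no; case: none; exists (m.+1%:R^-1); first by rewrite invr_gt0 ltr0Sn.
  by move=> x xr Ex; apply: contrapT => xp; case: no; exists x.
have [x Hx] := choice H.
have xp : mlimU x p.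
  move=> i j; rewrite ord1; apply/ulimP => e e0.
  have /ulimP/(_ e e0) := invU; apply: filterS => m.
  rewrite subr0 ger0_norm ?invr_ge0 ?ler0n //; apply: le_lt_trans.
  by have [] := Hx m.
have EE : \forall m \near U, E 0 (x m) = E 0 p.
  by apply: nearW => m; have [_ [-> _]] := Hx m.
have cst0 : ulimU (fun=> 0) 0 by apply: ulim_cst.
have cstp : mlimU (fun=> p) p by apply: mlim_cst.
have /filter_ex [m] := zeros_near_unique cst0 xp cstp EE.
by have [_ []] := Hx m.
Qed.

Lemma zeros_persist : exists2 x, mlimU x p & \forall m \near U, E (s m) (x m) = 0.
Proof.
have [r r0 rzero] := isolated_zero.
have H m : exists x, in_polydisc r x /\
    forall y, in_polydisc r y -> sqnorm (E (s m) x) <= sqnorm (E (s m) y).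
  by have [x xr xmin] := sqnorm_attains_min (s m) (ltW r0); exists x.
have [x Hx] := choice H.
have [x0 xx0] := polydisc_bounded_lim (fun m => (Hx m).1).
(* The minimum is at most the value at [p], which tends to 0, so the limit is a zero in the
   isolating polydisc. Hence the minimisers approach its centre and are eventually interior. *)
have xp : x0 = p.
  apply: rzero; first exact: polydisc_lim (fun m => (Hx m).1) xx0.
  apply: sqnorm_le0.
  rewrite -[leRHS](_ : sqnorm (E 0 p) = 0); last first.
    by rewrite Ep /sqnorm big1 // => j _; rewrite mxE normr0 expr0n.
  apply: (ulim_le (u := fun m => sqnorm (E (s m) (x m))) (v := fun m => sqnorm (E (s m) p))).
  - apply: nearW => m; apply: (Hx m).2 => j; by rewrite subrr normr0 ltW.
  - by apply: ulim_sqnorm; apply: (contE s0 xx0).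
  by apply: ulim_sqnorm; apply: (contE s0); apply: mlim_cst.
rewrite xp in xx0; exists x => //.
have int : \forall m \near U, forall j, `|x m 0 j - p 0 j| < r.
  by apply: near_forall_fin => j; have /ulimP/(_ _ r0) := xx0 0 j.
apply: filterS2 int (mlim_unit Qp (contQ s0 xx0 xx0)) => m mint um.
exact: interior_min_zero mint (Hx m).2 um.
Qed.

End ZeroPerturbation.

(** * Lowering one pivot *)

Section Lowering.
Variables k n : nat.
Implicit Types d : 'I_k -> 'I_n.

(** The last clause interlaces the two types: it makes both increasing, and it makes the block
    [colsub d1 B] lower triangular for every [B] supported below [d]. *)
Definition lowers d i d1 : Prop :=
  [/\ (d1 i).+1 = d i :> nat, forall j, j != i -> d1 j = d j
    & forall j l : 'I_k, (j < l)%N -> (d j < d1 l)%N].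

Lemma lowers_le d i d1 : lowers d i d1 -> forall j, (d1 j <= d j)%N.
Proof.
by case=> di dj _ j; have [->|/dj -> //] := eqVneq j i; rewrite -di leqnSn.
Qed.

Lemma lowers_increasing d i d1 : lowers d i d1 -> increasing d /\ increasing d1.
Proof.
move=> low; have le := lowers_le low; case: low => _ _ gap.
split=> j l jl; first exact: leq_trans (gap _ _ jl) (le l).
exact: leq_ltn_trans (le j) (gap _ _ jl).
Qed.

Lemma lowers_sum d i d1 : lowers d i d1 -> (\sum_j d j = (\sum_j d1 j).+1)%N.
Proof.
case=> di dj _; rewrite (bigD1 i) //= [X in (_ = X.+1)%N](bigD1 i) //= -di addSn.
by congr (_ + _).+1; apply: eq_bigr => j /dj ->.
Qed.

(** Coordinates on planes of type at most [d] near one of type [d1]. Freezing the pivot columns of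
    [d1] removes the freedom of changing basis. *)
Definition free_coord d d1 : pred ('I_k * 'I_n) :=
  fun jb => (jb.2 <= d jb.1)%N && (jb.2 \notin codom d1).

(** Row [j] has [d j + 1] columns available, of which exactly the pivots [d1 0, ..., d1 j] are
    excluded by interlacing, leaving [d j - j]. There are thus as many unknowns as prescribed
    roots. *)
Lemma card_free_coord d i d1 m : lowers d i d1 ->
  (\sum_j d j = m + \sum_(j < k) j)%N -> #|free_coord d d1| = m.
Proof.
move=> low dm; have [_ /increasing_inj inj] := lowers_increasing low.
have le := lowers_le low; have [_ _ gap] := low; have [inc _] := lowers_increasing low.
have cnt_pivots (j : 'I_k) : (\sum_(b < n | (b <= d j)%N && (b \in codom d1)) 1 = j.+1)%N.
  rewrite sum1_card -(card_ord j.+1).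
  have jk (l : 'I_j.+1) : (l < k)%N by apply: leq_trans (ltn_ord l) (ltn_ord j).
  rewrite -(@card_imset _ _ (fun l => d1 (Ordinal (jk l)))); last first.
    by move=> a b /inj/(congr1 val)/= /val_inj.
  apply: eq_card => b; rewrite [LHS](_ : _ = (b <= d j)%N && (b \in codom d1)) //.
  apply/idP/imsetP => [|[l _ ->]].
    case/andP=> bj /codomP [l bl]; have lj : (l < j.+1)%N.
      by rewrite ltnNge; apply/negP => /gap; rewrite -bl ltnNge bj.
    by exists (Ordinal lj) => //; rewrite bl; congr d1; apply: val_inj.
  rewrite codom_f andbT; apply: leq_trans (le _) _.
  have : (l <= j)%N by rewrite -ltnS.
  rewrite leq_eqVlt => /orP[/eqP lj|lj]; last exact/ltnW/inc.
  by have -> : Ordinal (jk l) = j by apply: val_inj.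
have cnt_all (j : 'I_k) : (\sum_(b < n | (b <= d j)%N) 1 = (d j).+1)%N.
  rewrite sum1_card -(card_ord (d j).+1).
  have jn (l : 'I_(d j).+1) : (l < n)%N by apply: leq_trans (ltn_ord l) (ltn_ord _).
  rewrite -(@card_imset _ _ (fun l => Ordinal (jn l))); last first.
    by move=> a b /(congr1 val)/= /val_inj.
  apply: eq_card => b; rewrite [LHS](_ : _ = (b <= d j)%N) //.
  apply/idP/imsetP => [bj|[l _ ->]]; last by rewrite -ltnS /=.
  by exists (Ordinal (bj : (b < (d j).+1)%N)) => //; apply: val_inj.
have cnt (j : 'I_k) : (\sum_(b < n | (b <= d j)%N && (b \notin codom d1)) 1 + j = d j)%N.
  apply/eqP; rewrite -eqSS -addnS -cnt_pivots -cnt_all addnC eq_sym.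
  by rewrite (bigID (fun b => b \in codom d1)).
rewrite -sum1_card (eq_bigl (fun jb => true && free_coord d d1 (jb.1, jb.2))); last by case.
rewrite -(pair_big_dep xpredT (fun j b => free_coord d d1 (j, b)) (fun _ _ => 1%N)) /=.
apply/eqP; rewrite -(eqn_add2r (\sum_(j < k) j)) -dm -big_split /=.
by apply/eqP/eq_bigr => j _; apply: cnt.
Qed.

End Lowering.

Lemma enum_card (I : finType) (P : pred I) m : #|P| = m ->
  exists2 c : 'I_m -> I, injective c & forall y, P y <-> exists a, c a = y.
Proof.
move=> <-; exists enum_val; first exact: enum_val_inj.
move=> y; split=> [Py|[a <-]]; last exact: enum_valP.
by exists (enum_rank_in Py y); rewrite enum_rankK_in.
Qed.

(** * Evaluation at roots that may lie at infinity, and limits of Wronskians *)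

Section HomogeneousEvaluation.
Variable F : fieldType.

(* m-homogeneous evaluation: a root tau/sigma may sit at infinity (sigma = 0), where only the coefficient of degree m survives. *)
Definition hev m (st : F * F) (q : {poly F}) : F :=
  \sum_(l < m.+1) q`_l * (st.1 ^+ (m - l) * st.2 ^+ l).

Lemma hev_is_linear m st : linear_for *%R (hev m st).
Proof.
move=> a q r; rewrite /hev mulr_sumr -big_split; apply: eq_bigr => l _ /=.
by rewrite coefD coefZ mulrDl mulrA.
Qed.
HB.instance Definition _ m st := GRing.isLinear.Build F {poly F} F *%R (hev m st) (hev_is_linear m st).

Lemma hev1 m t (q : {poly F}) : (size q <= m.+1)%N -> hev m (1, t) q = q.[t].
Proof.
move=> sq; rewrite (horner_coef_wide t sq); apply: eq_bigr => l _ /=.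
by rewrite expr1n mul1r.
Qed.

Lemma hev_inv m t (q : {poly F}) : t != 0 -> (size q <= m.+1)%N -> t ^+ m * hev m (t^-1, 1) q = q.[t].
Proof.
move=> t0 sq; rewrite (horner_coef_wide t sq) mulr_sumr; apply: eq_bigr => l _ /=.
rewrite expr1n mulr1 mulrCA; congr (_ * _).
by rewrite exprVn -exprB ?unitfE ?leq_subr // subKn // -ltnS.
Qed.

Lemma hev0 m q : hev m (0, 1) q = q`_m.
Proof.
rewrite /hev (bigD1 ord_max) //= subnn expr0 expr1n !mulr1 big1 ?addr0 // => l lm.
rewrite expr0n subn_eq0 leqNgt; have -> : (l < m)%N.
  by rewrite ltn_neqAle -ltnS ltn_ord andbT.
by rewrite mul0r mulr0.
Qed.

End HomogeneousEvaluation.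

Section PolynomialLimits.
Variables (C : numClosedFieldType) (U : set_system nat).
Context {ultraU : UltraFilter U}.

(** No uniform degree bound is asked for: [hev m] reads only the coefficients up to degree [m]. *)
Definition plim (q : nat -> {poly C}) (q0 : {poly C}) : Prop :=
  forall l, ulim U (fun m => (q m)`_l) q0`_l.

Lemma plim_ext q r q0 r0 : (forall m, q m = r m) -> q0 = r0 -> plim r r0 -> plim q q0.
Proof. by move=> /funext -> ->. Qed.

Lemma plim_cst q : plim (fun=> q) q.
Proof. by move=> l; apply: ulim_cst. Qed.

Lemma plimM q r q0 r0 : plim q q0 -> plim r r0 -> plim (fun m => q m * r m) (q0 * r0).
Proof.
move=> qq rr l; rewrite coefM; under eq_fun do rewrite coefM.
by apply: ulim_sum => j; apply: ulimM.
Qed.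

Lemma plim_sum I (r : seq I) (P : pred I) (u : I -> nat -> {poly C}) (a : I -> {poly C}) :
  (forall i, plim (u i) (a i)) ->
  plim (fun m => \sum_(i <- r | P i) u i m) (\sum_(i <- r | P i) a i).
Proof.
move=> H l; rewrite coef_sum; under eq_fun do rewrite coef_sum.
by apply: ulim_sum => i; apply: H.
Qed.

Lemma plim_prod I (r : seq I) (P : pred I) (u : I -> nat -> {poly C}) (a : I -> {poly C}) :
  (forall i, plim (u i) (a i)) ->
  plim (fun m => \prod_(i <- r | P i) u i m) (\prod_(i <- r | P i) a i).
Proof.
move=> H; elim: r => [|i r IH].
  by rewrite big_nil; under eq_fun do rewrite big_nil; apply: plim_cst.
rewrite big_cons; under eq_fun do rewrite big_cons.
by case: (P i) => //; apply: plimM.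
Qed.

Lemma plim_det q (x : nat -> 'M[{poly C}]_q) (a : 'M[{poly C}]_q) : (forall i j, plim (fun m => x m i j) (a i j)) ->
  plim (fun m => \det (x m)) (\det a).
Proof.
move=> xa; apply: plim_sum => s; apply: plimM; first exact: plim_cst.
by apply: plim_prod => i; apply: xa.
Qed.

Lemma ulim_hev m (st : nat -> C * C) st0 q q0 : ulim U (fun a => (st a).1) st0.1 ->
  ulim U (fun a => (st a).2) st0.2 -> plim q q0 ->
  ulim U (fun a => hev m (st a) (q a)) (hev m st0 q0).
Proof.
move=> s1 s2 qq; have ulimX l u u0 : ulim U u u0 -> ulim U (fun a => u a ^+ l : C) (u0 ^+ l).
  move=> uu; elim: l => [|l IH]; first exact: ulim_cst.
  by rewrite exprS; under eq_fun do rewrite exprS; apply: ulimM.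
apply: ulim_sum => l; apply: ulimM; first exact: qq.
by apply: ulimM; apply: ulimX.
Qed.

Variables k n : nat.

Lemma plim_lift_wr (A : nat -> 'M[C]_(k, n)) A0 : mlim U A A0 ->
  forall i j, plim (fun m => lift_wr (A m) i j) (lift_wr A0 i j).
Proof.
move=> AA i j; rewrite mxE; under eq_fun do rewrite mxE.
apply: plim_sum => b; apply: plimM; last exact: plim_cst.
move=> l; rewrite mxE coefC; under eq_fun do rewrite mxE coefC.
by case: (l == 0)%N; [apply: AA|apply: ulim_cst].
Qed.

Lemma plim_wr (A : nat -> 'M[C]_(k, n)) A0 : mlim U A A0 -> plim (fun m => wr (A m)) (wr A0).
Proof. by move=> AA; apply: plim_det; apply: plim_lift_wr. Qed.

Lemma plim_wr_quot (A A' : nat -> 'M[C]_(k, n)) A0 A'0 : mlim U A A0 -> mlim U A' A'0 ->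
  forall i b, plim (fun m => wr_quot (A m) (A' m) i b) (wr_quot A0 A'0 i b).
Proof.
move=> AA AA' i b.
have E X Y : wr_quot X Y i b = \sum_(j < k)
    ((-1) ^+ (i + j) * \det (row' i (col' j (mix_rows (lift_wr X) (lift_wr Y) i)))) * (wr_mx C k n : 'M[{poly C}]_(n, k)) b j.
  by rewrite mxE; apply: eq_bigr => j _; rewrite [X in _ * X]mxE [det_quot _ _ _ _]mxE.
apply: (plim_ext (fun m => E (A m) (A' m)) (E A0 A'0)).
apply: plim_sum => j; apply: plimM; last exact: plim_cst.
apply: plimM; first exact: plim_cst.
apply: plim_det => u v.
have M (X Y : 'M[C]_(k, n)) : row' i (col' j (mix_rows (lift_wr X) (lift_wr Y) i)) u v =
    if (lift i u < i)%N then lift_wr Y (lift i u) (lift j v) else lift_wr X (lift i u) (lift j v).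
  by rewrite 3!mxE.
apply: (plim_ext (fun m => M (A m) (A' m)) (M A0 A'0)).
by case: ifP => _; apply: plim_lift_wr.
Qed.

End PolynomialLimits.

(** * Charts around a solution of lower type *)

Section Solutions.
Variable C : numClosedFieldType.
Variables k n : nat.
Implicit Types (A B : 'M[C]_(k, n)) (d : 'I_k -> 'I_n) (T : seq nat).

Definition wr_vanishes T A : Prop := forall t, t \in T -> (wr A).[t%:R] = 0.

(** An infinitesimal deformation below [d] that keeps the roots [T] is a mere change of basis: the
    conditions are transverse at [A]. *)
Definition nondegenerate d T A : Prop := forall B, supp_le d B ->
  (forall t, t \in T -> (dwr A B).[t%:R] = 0) -> (B <= A)%MS.

Definition conj_mx p q (A : 'M[C]_(p, q)) : 'M[C]_(p, q) := map_mx Num.conj A.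

Definition real_mx p q (A : 'M[C]_(p, q)) : Prop := conj_mx A = A.

Lemma wr_conj A : wr (conj_mx A) = map_poly Num.conj (wr A).
Proof.
rewrite /wr -det_map_mx; congr (\det _); rewrite /lift_wr map_mxM; congr (_ *m _).
  by apply/matrixP => i j; rewrite !mxE /= map_polyC.
by apply/matrixP => i j; rewrite !mxE rmorphMn /= map_polyXn.
Qed.

Lemma wr_vanishes_conj T A : wr_vanishes T A -> wr_vanishes T (conj_mx A).
Proof.
move=> H t /H Ht; rewrite wr_conj -[t%:R](rmorph_nat (@Num.conj C)) horner_map /=.
by rewrite Ht rmorph0.
Qed.

End Solutions.

Lemma mlim_matrix (C : numClosedFieldType) (U : set_system nat) p q
    (x : nat -> 'I_p -> 'I_q -> C) (a : 'I_p -> 'I_q -> C) :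
  (forall i j, ulim U (fun m => x m i j) (a i j)) ->
  mlim U (fun m => \matrix_(i, j) x m i j) (\matrix_(i, j) a i j).
Proof. by move=> H i j; rewrite mxE; under eq_fun do rewrite mxE; apply: H. Qed.

Section Chart.
Variables (C : numClosedFieldType) (U : set_system nat).
Context {ultraU : UltraFilter U}.
Hypothesis complU : ultra_complete C U.
Hypothesis minC : has_approx_min C.
Hypothesis invU : ulim U (fun m => (m.+1%:R : C)^-1) 0.

Variables (k n : nat) (d d1 : 'I_k -> 'I_n) (i0 : 'I_k) (m : nat) (T : seq nat).
Hypothesis low : lowers d i0 d1.
Hypothesis d_sum : (\sum_j d j = m.+1 + \sum_(j < k) j)%N.
Hypothesis uniqT : uniq T.
Hypothesis sizeT : size T = m.

Variable p : 'M[C]_(k, n).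
Hypothesis p_type : has_type d1 p.
Hypothesis p_zero : wr_vanishes T p.
Hypothesis p_nondeg : nondegenerate d1 T p.

Let d1_sum : (\sum_j d1 j = m + \sum_(j < k) j)%N.
Proof. by apply/eqP; rewrite -eqSS -(lowers_sum low) d_sum. Qed.

Lemma center_supp : supp_le d p.
Proof. by move=> i b ib; apply: p_type.1; apply: leq_ltn_trans ib; apply: lowers_le low i. Qed.

Lemma center_corner_eq0 : p i0 (d i0) = 0.
Proof. by apply: p_type.1; case: low => <-. Qed.

Lemma pivot_block_unit : colsub d1 p \in unitmx.
Proof. exact: type_colsub_unit (lowers_increasing low).2 p_type. Qed.

Lemma coords_exist : exists2 c : 'I_m.+1 -> 'I_k * 'I_n, injective c &
  forall y, free_coord d d1 y <-> exists a, c a = y.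
Proof. exact: enum_card (card_free_coord low d_sum). Qed.

Section Coordinates.
Variable c : 'I_m.+1 -> 'I_k * 'I_n.
Hypothesis c_inj : injective c.
Hypothesis c_onto : forall y, free_coord d d1 y <-> exists a, c a = y.

Definition coord_mx (x : 'rV[C]_m.+1) : 'M[C]_(k, n) :=
  \matrix_(i, b) \sum_a x 0 a * (c a == (i, b))%:R.

Definition chart (x : 'rV[C]_m.+1) : 'M[C]_(k, n) := p + coord_mx x.

(** The last slot [(s, 1)] encodes the root [1/s], with [s = 0] at infinity. The limit problem and
    its deformation thus belong to one family, continuous in [s]. *)
Definition node (s : C) (e : 'I_m.+1) : C * C :=
  if (e < m)%N then (1, (nth 0%N T e)%:R) else (s, 1).

Definition chart_eqn (s : C) (x : 'rV[C]_m.+1) : 'rV[C]_m.+1 :=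
  \row_e hev m.+1 (node s e) (wr (chart x)).

Definition chart_quot (s : C) (x y : 'rV[C]_m.+1) : 'M[C]_m.+1 :=
  \matrix_(a, e) hev m.+1 (node s e) (wr_quot (chart x) (chart y) (c a).1 (c a).2).

Lemma coord_pairing (x : 'rV[C]_m.+1) (q : 'M[{poly C}]_(k, n)) :
  \sum_i \sum_b coord_mx x i b *: q i b = \sum_a x 0 a *: q (c a).1 (c a).2.
Proof.
rewrite pair_bigA /=.
under eq_bigr do rewrite mxE scaler_suml.
rewrite exchange_big /=; apply: eq_bigr => a _.
rewrite (bigD1 (c a)) //= -surjective_pairing eqxx mulr1 big1 ?addr0 // => ib ne.
by rewrite -surjective_pairing eq_sym (negPf ne) mulr0 scale0r.
Qed.

Lemma coord_mxB x y : coord_mx (x - y) = coord_mx x - coord_mx y.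
Proof.
apply/matrixP => i b; rewrite !mxE -sumrB; apply: eq_bigr => a _.
by rewrite !mxE mulrBl.
Qed.

Lemma chart_eqnB s x y : chart_eqn s x - chart_eqn s y = (x - y) *m chart_quot s x y.
Proof.
apply/rowP => e; rewrite !mxE -linearB /= wr_sub_quot.
have -> : chart x - chart y = coord_mx (x - y).
  by rewrite coord_mxB /chart opprD addrACA subrr add0r.
rewrite coord_pairing linear_sum; apply: eq_bigr => a _.
by rewrite linearZ /= [chart_quot _ _ _ _ _]mxE.
Qed.

Lemma coord_mx_supp x : supp_le d (coord_mx x).
Proof.
move=> i b ib; rewrite mxE big1 // => a _; case: eqP => [ca|]; last by rewrite mulr0.
have /c_onto : exists a, c a = (i, b) by exists a.
by move/andP=> [/=]; rewrite leqNgt ib.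
Qed.

Lemma coord_mx_pivots x : colsub d1 (coord_mx x) = 0.
Proof.
apply/matrixP => i j; rewrite !mxE big1 // => a _.
case: eqP => [ca|]; last by rewrite mulr0.
have /c_onto : exists a, c a = (i, d1 j) by exists a.
by move/andP=> [_ /=]; rewrite codom_f.
Qed.

Definition coords (B : 'M[C]_(k, n)) : 'rV[C]_m.+1 := \row_a B (c a).1 (c a).2.

Lemma coordsK B : supp_le d B -> colsub d1 B = 0 -> coord_mx (coords B) = B.
Proof.
move=> sB B0; apply/matrixP => i b; rewrite mxE.
have [/c_onto [a ca]|nf] := boolP (free_coord d d1 (i, b)).
  rewrite (bigD1 a) //= mxE ca eqxx mulr1 big1 ?addr0 // => a' a'a.
  by rewrite -ca (inj_eq c_inj) (negPf a'a) mulr0.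
rewrite big1 => [|a _]; last first.
  case: eqP => [ca|]; last by rewrite mulr0.
  by case/negP: nf; apply/c_onto; exists a.
move: nf; rewrite /free_coord negb_and negbK -ltnNge /= => /orP[ib|/codomP[j ->]].
  by rewrite sB.
by move/matrixP/(_ i j): B0; rewrite !mxE.
Qed.

Lemma node_lim (s : nat -> C) s0 e : ulim U s s0 ->
  ulim U (fun a => (node (s a) e).1) (node s0 e).1 /\
  ulim U (fun a => (node (s a) e).2) (node s0 e).2.
Proof. by rewrite /node => ss; case: ifP => _; split => //=; apply: ulim_cst. Qed.

Lemma chart_lim (x : nat -> 'rV[C]_m.+1) x0 : mlim U x x0 ->
  mlim U (fun a => chart (x a)) (chart x0).
Proof.
move=> xx i b; rewrite !mxE; under eq_fun do rewrite !mxE.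
apply: ulimD; first exact: ulim_cst.
by apply: ulim_sum => a; apply: ulimM; [apply: xx|apply: ulim_cst].
Qed.

Lemma chart_eqn_lim s s0 (x : nat -> 'rV[C]_m.+1) x0 : ulim U s s0 -> mlim U x x0 ->
  mlim U (fun a => chart_eqn (s a) (x a)) (chart_eqn s0 x0).
Proof.
move=> ss xx i e; rewrite mxE; under eq_fun do rewrite mxE.
have [n1 n2] := node_lim e ss.
by apply: ulim_hev => //; apply: plim_wr; apply: chart_lim.
Qed.

Lemma chart_quot_lim s s0 (x : nat -> 'rV[C]_m.+1) x0 (y : nat -> 'rV[C]_m.+1) y0 :
  ulim U s s0 -> mlim U x x0 -> mlim U y y0 ->
  mlim U (fun a => chart_quot (s a) (x a) (y a)) (chart_quot s0 x0 y0).
Proof.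
move=> ss xx yy.
apply: (mlim_matrix
  (x := fun q a e => hev m.+1 (node (s q) e) (wr_quot (chart (x q)) (chart (y q)) (c a).1 (c a).2))
  (a := fun a e => hev m.+1 (node s0 e) (wr_quot (chart x0) (chart y0) (c a).1 (c a).2))) => i e.
have [n1 n2] := node_lim e ss.
by apply: ulim_hev => //; apply: plim_wr_quot; apply: chart_lim.
Qed.

Lemma chart0 : chart 0 = p.
Proof.
rewrite /chart; have -> : coord_mx 0 = 0; last by rewrite addr0.
by apply/matrixP => i b; rewrite !mxE big1 // => a _; rewrite mxE mul0r.
Qed.

Lemma chart_supp x : supp_le d (chart x).
Proof. by move=> i b ib; rewrite mxE center_supp // coord_mx_supp // addr0. Qed.

Lemma chart_pivots x : colsub d1 (chart x) = colsub d1 p.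
Proof.
have := coord_mx_pivots x => /matrixP H; apply/matrixP => i j.
by move: (H i j); rewrite !mxE => ->; rewrite addr0.
Qed.

Lemma chart_wr_size x : (size (wr (chart x)) <= m.+2)%N.
Proof. exact: (wr_top (chart_supp x) d_sum).1. Qed.

Lemma center_wr_size : (size (wr p) <= m.+1)%N.
Proof. exact: (wr_top p_type.1 d1_sum).1. Qed.

(** At infinity the last equation reads the coefficient of degree [m.+1], which vanishes because the
    lower type [d1] bounds the degree of [wr p] by [m]. *)
Lemma chart_eqn_center : chart_eqn 0 0 = 0.
Proof.
apply/rowP => e; rewrite !mxE chart0 /node; case: ifP => em.
  rewrite hev1 ?p_zero //; first by rewrite mem_nth ?sizeT.
  by apply: leq_trans center_wr_size _.
by rewrite hev0 nth_default // center_wr_size.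
Qed.

(* The kernel of the Jacobian at p with the last root at infinity: the top coefficient kills the new coordinate, then nondegeneracy of p applies. *)
Lemma chart_quot_center_unit : chart_quot 0 0 0 \in unitmx.
Proof.
rewrite unitmxE unitfE; apply/det0P => -[v v0 vQ]; case/eqP: v0.
set B := coord_mx v.
have sB : supp_le d B := coord_mx_supp v.
have Be e : hev m.+1 (node 0 e) (dwr p B) = 0.
  rewrite -[RHS](_ : (v *m chart_quot 0 0 0) 0 e = 0); last by rewrite vQ mxE.
  rewrite [RHS]mxE /dwr coord_pairing linear_sum; apply: eq_bigr => a _.
  by rewrite linearZ /= [chart_quot _ _ _ _ _]mxE chart0.
have Bi0 : B i0 (d i0) = 0.
  have := Be ord_max; rewrite /node ltnn hev0.
  rewrite (dwr_top center_supp sB d_sum center_corner_eq0) => /eqP; rewrite !mulf_eq0.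
  have -> : falling_det C (fun i => d i) == 0 = false.
    have inj := increasing_inj (lowers_increasing low).1.
    by apply/negbTE/falling_det_neq0 => a b /val_inj/inj.
  have -> : \prod_(j | j != i0) p j (d j) == 0 = false.
    apply/negbTE/prodf_neq0 => j ji; case: low => _ dj _.
    by rewrite -dj // p_type.2.
  by rewrite orbF => /eqP.
have sB1 : supp_le d1 B.
  move=> i b ib; have [lt|ge] := ltnP (d i) b; first exact: sB.
  case: low => di dj _; have [ii|ii] := eqVneq i i0; last by rewrite dj // ltnNge ge in ib.
  rewrite ii in ib ge *; suff -> : b = d i0 by [].
  by apply: val_inj; move: ib ge di => /=; lia.
have size_dwr : (size (dwr p B) <= m.+2)%N.
  rewrite dwr_rows; apply: leq_trans (size_sum _ _ _) _; apply/bigmax_leqP => i _.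
  apply: (wr_top _ d_sum).1 => a b ab; rewrite mxE; case: eqP => [<-|_].
    by rewrite mxE sB.
  exact: center_supp.
have : (B <= p)%MS.
  apply: p_nondeg => // t tT; have tm : (index t T < m)%N by rewrite -sizeT index_mem.
  have := Be (widen_ord (leqnSn m) (Ordinal tm)).
  by rewrite /node /= tm nth_index // hev1.
case/submxP => L BL.
have : L *m colsub d1 p = 0 by rewrite -colsub_mulmx -BL coord_mx_pivots.
move/(congr1 (mulmxr (invmx (colsub d1 p)))); rewrite /= mulmxK ?pivot_block_unit // mul0mx => L0.
apply/rowP => a; have : B (c a).1 (c a).2 = 0 by rewrite BL L0 mul0mx mxE.
rewrite mxE (bigD1 a) //= -surjective_pairing eqxx mulr1 big1 => [|b ba].
  by rewrite addr0 mxE.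
by rewrite (inj_eq c_inj) (negPf ba) mulr0.
Qed.

Lemma chart_coords B : supp_le d B -> colsub d1 B = colsub d1 p ->
  chart (coords (B - p)) = B.
Proof.
move=> sB Bp; rewrite /chart coordsK; first by rewrite addrC subrK.
  by move=> i b ib; rewrite !mxE sB // center_supp // subrr.
by apply/matrixP => i j; move/matrixP/(_ i j): Bp; rewrite !mxE => ->; rewrite subrr.
Qed.

Lemma chart_eqn_vanishes q x : chart_eqn (q.+1%:R)^-1 x = 0 <-> wr_vanishes (q.+1 :: T) (chart x).
Proof.
have q0 : q.+1%:R != 0 :> C by rewrite pnatr_eq0.
split=> [/rowP E t|H].
  rewrite inE => /orP[/eqP ->|tT].
    have := E ord_max; rewrite !mxE /node ltnn => E0.
    by rewrite -(hev_inv q0 (chart_wr_size x)) E0 mulr0.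
  have tm : (index t T < m)%N by rewrite -sizeT index_mem.
  have := E (widen_ord (leqnSn m) (Ordinal tm)).
  by rewrite !mxE /node /= tm nth_index // hev1 // chart_wr_size.
apply/rowP => e; rewrite !mxE /node; case: ifP => em.
  rewrite hev1 ?chart_wr_size //; apply: H; rewrite inE mem_nth ?orbT //.
  by rewrite sizeT.
have := H q.+1; rewrite inE eqxx => /(_ isT).
rewrite -(hev_inv q0 (chart_wr_size x)) => /eqP.
by rewrite mulf_eq0 expf_eq0 (negPf q0) andbF => /eqP.
Qed.

(** A direction [B] is moved into the chart by subtracting a multiple [L *m A], which changes no
    value of [dwr] at the roots; in the chart the invertible Jacobian forces the remainder to be
    0. *)
Lemma chart_quot_nondegenerate q x : chart_quot (q.+1%:R)^-1 x x \in unitmx ->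
  wr_vanishes (q.+1 :: T) (chart x) -> nondegenerate d (q.+1 :: T) (chart x).
Proof.
set A := chart x => Qu Az B sB Bz.
have [inc inc1] := lowers_increasing low; case: (low) => _ _ gap.
(* Chosen to cancel the pivot columns of [B]. Triangularity of [L] is what keeps [L *m A] supported
   below [d]. *)
pose L := colsub d1 B *m invmx (colsub d1 p).
have tL : is_trig_mx L.
  apply: mulmx_trig; first exact: trig_supp gap sB.
  by apply: invmx_trig pivot_block_unit; apply: trig_supp inc1 p_type.1.
set B' := B - L *m A.
have sB' : supp_le d B'.
  move=> i b ib; rewrite !mxE sB // sub0r; apply/eqP; rewrite oppr_eq0; apply/eqP.
  by have := supp_le_mulmx inc tL (chart_supp x) ib; rewrite mxE.
have pB' : colsub d1 B' = 0.
  have -> : colsub d1 B' = colsub d1 B - colsub d1 (L *m A).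
    by apply/matrixP => i j; rewrite !mxE.
  by rewrite colsub_mulmx chart_pivots /L mulmxKV ?pivot_block_unit // subrr.
have B'z t : t \in q.+1 :: T -> (dwr A B').[t%:R] = 0.
  by move=> tT; rewrite dwrB hornerD hornerN Bz // dwr_mulmx hornerZ Az // mulr0 subr0.
have size_dwr : (size (dwr A B') <= m.+2)%N.
  rewrite dwr_rows; apply: leq_trans (size_sum _ _ _) _; apply/bigmax_leqP => i _.
  apply: (wr_top _ d_sum).1 => a b ab; rewrite mxE; case: eqP => [<-|_].
    by rewrite mxE sB'.
  exact: chart_supp ab.
have q0 : q.+1%:R != 0 :> C by rewrite pnatr_eq0.
have : coords B' *m chart_quot (q.+1%:R)^-1 x x = 0.
  apply/rowP => e; rewrite !mxE.
  transitivity (hev m.+1 (node (q.+1%:R)^-1 e) (dwr A B')).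
    rewrite /dwr -[in RHS](coordsK sB' pB') coord_pairing linear_sum.
    by apply: eq_bigr => a _; rewrite linearZ /= [chart_quot _ _ _ _ _]mxE.
  rewrite /node; case: ifP => em.
    by rewrite hev1 // B'z // inE mem_nth ?orbT // sizeT.
  have := B'z q.+1; rewrite inE eqxx => /(_ isT).
  rewrite -(hev_inv q0 size_dwr) => /eqP.
  by rewrite mulf_eq0 expf_eq0 (negPf q0) andbF => /eqP.
move/(congr1 (mulmxr (invmx (chart_quot (q.+1%:R)^-1 x x)))); rewrite /= mulmxK // mul0mx => c0.
have B'0 : B' = 0.
  by rewrite -(coordsK sB' pB') c0; apply/matrixP => i b; rewrite !mxE big1 // => a _; rewrite mxE mul0r.
by apply/submxP; exists L; apply/eqP; rewrite -subr_eq0; apply/eqP.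
Qed.

Lemma coords_lim (A : nat -> 'M[C]_(k, n)) : mlim U A p ->
  mlim U (fun q => coords (A q - p)) 0.
Proof.
move=> Ap i a; rewrite mxE -(subrr (p (c a).1 (c a).2)).
have -> : (fun q => coords (A q - p) i a) =
  (fun q => A q (c a).1 (c a).2 - p (c a).1 (c a).2) by apply: funext => q; rewrite !mxE.
by apply: ulimB => //; apply: ulim_cst.
Qed.

End Coordinates.

(** Fixing the pivot block to that of [p] selects a single matrix in each row space, so uniqueness
    can be an equality of matrices. *)
Definition chart_solution q A : Prop :=
  [/\ supp_le d A, colsub d1 A = colsub d1 p & wr_vanishes (q.+1 :: T) A].

Lemma chart_solution_unique (A B : nat -> 'M[C]_(k, n)) : mlim U A p -> mlim U B p ->
  (\forall q \near U, chart_solution q (A q)) -> (\forall q \near U, chart_solution q (B q)) ->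
  \forall q \near U, A q = B q.
Proof.
have [c c_inj c_onto] := coords_exist.
move=> Ap Bp solA solB.
have sol X q : chart_solution q X -> chart_eqn c (q.+1%:R)^-1 (coords c (X - p)) = 0.
  case=> sX pX zX; apply/chart_eqn_vanishes => //.
  by rewrite chart_coords.
have EE : \forall q \near U, chart_eqn c (q.+1%:R)^-1 (coords c (A q - p)) =
    chart_eqn c (q.+1%:R)^-1 (coords c (B q - p)).
  by apply: filterS2 solA solB => q /sol -> /sol ->.
have H : \forall q \near U, coords c (A q - p) = coords c (B q - p).
  exact: (zeros_near_unique (chart_eqnB c) (chart_quot_lim (c:=c)) (chart_quot_center_unit c_inj c_onto)
    invU (coords_lim c Ap) (coords_lim c Bp) EE).
apply: filterS3 solA solB H => q [sA pA _] [sB pB _] E.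
by rewrite -(chart_coords c_inj c_onto sA pA) E chart_coords.
Qed.

Lemma near_new_root : \forall q \near U, q.+1 \notin T.
Proof.
pose t0 := (\max_(t <- T) t).+1.
have t00 : 0 < (t0%:R : C)^-1 by rewrite invr_gt0 ltr0n.
have /ulimP/(_ _ t00) := invU; apply: filterS => q.
rewrite subr0 ger0_norm ?invr_ge0 ?ler0n // ltf_pV2 ?posrE ?ltr0n // ltr_nat ltnS => lt.
apply/negP => qT; have := leq_bigmax_seq (P := xpredT) (F := id) q.+1 qT isT.
by rewrite leqNgt ltnS ltnW.
Qed.

(** Only the corner entry could fail to be nonzero. If it vanished, [A] would have type [d1], and
    its nonzero Wronskian of degree [m] would have the [m + 1] distinct roots [q.+1 :: T]. *)
Lemma chart_solution_type q A : q.+1 \notin T -> chart_solution q A -> has_type d A.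
Proof.
move=> qT [sA pA zA]; split=> // j; case: (low) => di dj _.
have piv l : A l (d1 l) = p l (d1 l) by move/matrixP/(_ l l): pA; rewrite !mxE.
have [->|ji] := eqVneq j i0; last by rewrite -dj // piv p_type.2.
apply/eqP => Ai0.
have sA1 : supp_le d1 A.
  move=> i b ib; have [lt|ge] := ltnP (d i) b; first exact: sA.
  have [ii|ii] := eqVneq i i0; last by rewrite dj // ltnNge ge in ib.
  rewrite ii in ib ge *; suff -> : b = d i0 by [].
  by apply: val_inj; move: ib ge di => /=; lia.
have [sz top] := wr_top sA1 d1_sum.
have wr0 : wr A != 0.
  apply: contraTneq (falling_det_neq0 C (d := fun i => d1 i) _) => [w0|a b]; last first.
    by move/val_inj; apply: increasing_inj (lowers_increasing low).2 _ _.
  apply/negPn/eqP; have /eqP := top; rewrite w0 coef0 eq_sym mulf_eq0 => /orP[/eqP //|].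
  by rewrite prodf_seq_eq0 => /hasP[l _ /=]; rewrite piv (negPf (p_type.2 l)).
have : (size [seq t%:R : C | t <- q.+1 :: T] < size (wr A))%N.
  apply: max_poly_roots => //; first by apply/allP => _ /mapP[t tT ->]; apply/rootP/zA.
  by rewrite map_inj_uniq ?cons_uniq ?qT // => a b /eqP; rewrite eqr_nat => /eqP.
by rewrite size_map [size _]/= sizeT ltnNge sz.
Qed.

Lemma chart_solutions_exist : exists2 A : nat -> 'M[C]_(k, n), mlim U A p &
  \forall q \near U, [/\ chart_solution q (A q), has_type d (A q)
    & nondegenerate d (q.+1 :: T) (A q)].
Proof.
have [c c_inj c_onto] := coords_exist.
have [x x0 xz] := zeros_persist complU minC invU (chart_eqnB c) (chart_eqn_lim (c:=c))
  (chart_quot_lim (c:=c)) invU (chart_quot_center_unit c_inj c_onto) (chart_eqn_center c).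
exists (fun q => chart c (x q)).
  have : mlim U (fun q => chart c (x q)) (chart c 0) by apply: chart_lim.
  by rewrite chart0.
have unitQ : \forall q \near U, chart_quot c (q.+1%:R)^-1 (x q) (x q) \in unitmx.
  exact: mlim_unit (chart_quot_center_unit c_inj c_onto) (chart_quot_lim (c:=c) invU x0 x0).
apply: filterS3 xz unitQ near_new_root => q zq uq qT.
have {}zq : wr_vanishes (q.+1 :: T) (chart c (x q)) by apply/chart_eqn_vanishes.
have sol : chart_solution q (chart c (x q)).
  by split=> //; [exact: chart_supp|exact: chart_pivots].
split=> //; first exact: chart_solution_type sol.
exact: chart_quot_nondegenerate.
Qed.

Lemma real_chart_solutions (A : nat -> 'M[C]_(k, n)) : real_mx p -> mlim U A p ->
  (\forall q \near U, chart_solution q (A q)) -> \forall q \near U, real_mx (A q).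
Proof.
move=> preal Ap solA; apply: chart_solution_unique => //.
  move=> i j; rewrite -preal mxE; under eq_fun do rewrite mxE.
  exact: ulim_conj.
apply: filterS solA => q [sA pA zA]; split.
- by move=> i b ib; rewrite mxE sA // conjC0.
- apply/matrixP => i j; rewrite mxE [conj_mx _ _ _]mxE; move/matrixP/(_ i j): pA.
  by rewrite !mxE => ->; move/matrixP/(_ i (d1 j)): preal; rewrite mxE.
exact: wr_vanishes_conj.
Qed.

End Chart.

(** * Row spaces and types *)

Lemma exists_max_norm (C : numClosedFieldType) (I : finType) (i0 : I) (g : I -> C) :
  exists i, forall j, `|g j| <= `|g i|.
Proof.
suff [i Hi] : exists i, forall j, j \in enum I -> `|g j| <= `|g i|.
  by exists i => j; apply: Hi; rewrite mem_enum.
elim: (enum I) => [|a l [i Hi]]; first by exists i0.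
case: (real_leP (normr_real (g a)) (normr_real (g i))) => [ai|ia].
  by exists i => j; rewrite inE => /orP[/eqP ->|/Hi].
exists a => j; rewrite inE => /orP[/eqP -> //|/Hi ji].
exact: le_trans ji (ltW ia).
Qed.

Lemma sum_succ_corner k (d e : 'I_k -> nat) : (forall j, (e j <= d j)%N) ->
  (\sum_j d j = (\sum_j e j).+1)%N ->
  exists i, (e i).+1 = d i /\ forall j, j != i -> e j = d j.
Proof.
move=> le sum; have : (\sum_j (d j - e j) == 1)%N.
  rewrite sumnB // sum subSn // subnn //.
case/sum_nat_eq1 => i [_ di dj]; exists i; split; first by have := le i; lia.
by move=> j ji; have := dj j ji isT; have := le j; lia.
Qed.

Section Ultra.
Variables (C : numClosedFieldType) (U : set_system nat).
Context {ultraU : UltraFilter U}.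

Lemma near_or_near_not (P : nat -> Prop) :
  (\forall q \near U, P q) \/ (\forall q \near U, ~ P q).
Proof. exact: (in_ultra_setVsetC [set q | P q]%classic ultraU). Qed.

(** Pigeonhole along [U], in place of passing to a subsequence. *)
Lemma near_const_fin (I : finType) (f : nat -> I) : exists i, \forall q \near U, f q = i.
Proof.
apply: contrapT => none.
have : \forall q \near U, forall i, f q <> i.
  apply: near_forall_fin => i; have [H|//] := near_or_near_not (fun q => f q = i).
  by case: none; exists i.
by case/filter_ex => q /(_ (f q)).
Qed.

Variables k n : nat.
Implicit Types (A B : nat -> 'M[C]_(k, n)).

(** The change of basis from [B q] to [A q] is determined by an invertible block of [B q], so it
    converges together with [A] and [B]. *)
Lemma eqmx_lim A B a b d d' : mlim U A a -> mlim U B b ->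
  colsub d a \in unitmx -> colsub d' b \in unitmx ->
  (\forall q \near U, (A q == B q)%MS) -> (a == b)%MS.
Proof.
move=> Aa Bb ua ub AB.
have Glim : mlim U (fun q => colsub d' (A q) *m invmx (colsub d' (B q)))
    (colsub d' a *m invmx (colsub d' b)).
  by apply: mlimM; [apply: mlim_colsub|apply: mlim_inv => //; apply: mlim_colsub].
have uB : \forall q \near U, colsub d' (B q) \in unitmx.
  by apply: mlim_unit ub _; apply: mlim_colsub.
have E : a = colsub d' a *m invmx (colsub d' b) *m b.
  apply: mlim_unique Aa _; apply: mlim_near (mlimM Glim Bb).
  apply: filterS2 uB AB => q uq /eqmxMunitP[G _ ->].
  by rewrite colsub_mulmx mulmxK.
have le : (a <= b)%MS by rewrite E submxMl.
by rewrite -(mxrank_leqif_eq le) (colsub_unit_rank ua) (colsub_unit_rank ub).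
Qed.

End Ultra.

Section TypesAndRowSpaces.
Variables (F : fieldType) (k n : nat).
Implicit Types (A B : 'M[F]_(k, n)) (d : 'I_k -> 'I_n).

Lemma eqmx_colsub_unit A B d : (A == B)%MS -> colsub d A \in unitmx -> colsub d B \in unitmx.
Proof. by case/eqmxMunitP => G uG ->; rewrite colsub_mulmx unitmx_mul uG. Qed.

(** The nonzero [d1]-minor of [B] gives a permutation with [d1 (s j) <= d1' j]; both types have the
    same sum, so equality holds throughout. At [j = i] this is impossible when [i] differs from
    [i']. *)
Lemma lowers_row_spaces d i i' d1 d1' A B : lowers d i d1 -> lowers d i' d1' ->
  has_type d1 A -> has_type d1' B -> (A == B)%MS -> i = i'.
Proof.
move=> low low' tA [sB _] AB; apply/eqP; apply: contraT => ii'.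
have [inc inc1] := lowers_increasing low.
have uB := eqmx_colsub_unit AB (type_colsub_unit inc1 tA).
have [s Hs] := minor_dominated sB uB.
have sumE : (\sum_j d1 (s j) = \sum_j d1' j)%N.
  rewrite -(reindex_inj (@perm_inj _ s) (P := xpredT) (F := fun j => d1 j : nat)) /=.
  by apply/eqP; rewrite -eqSS -(lowers_sum low) (lowers_sum low').
have /= leif := leqif_sum (fun j (_ : xpredT j) => leqif_eq (Hs j)).
have /forallP Eq : [forall j, d1 (s j) == d1' j :> nat] by rewrite -leif sumE.
case: low low' => di dj _ [_ dj' _].
have := eqP (Eq i); rewrite dj' //; have [->|si] := eqVneq (s i) i; first by rewrite -di; lia.
by rewrite dj // => /val_inj/(increasing_inj inc)/eqP; rewrite (negPf si).
Qed.

Definition lower_at d i : 'I_k -> 'I_n :=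
  fun l => if l == i then Ordinal (leq_ltn_trans (leq_pred (d i)) (ltn_ord (d i))) else d l.

(** For increasing [d], these are the removable boxes of the partition [d i - i]. *)
Definition corner d i : bool := (0 < d i)%N && [forall l, (d l).+1 != d i].

Lemma corner_lowers d i : increasing d -> corner d i -> lowers d i (lower_at d i).
Proof.
move=> inc /andP[di /forallP nd]; split.
- by rewrite /lower_at eqxx /= prednK.
- by move=> j /negPf ji; rewrite /lower_at ji.
move=> j l /inc; rewrite /lower_at; case: eqP => [->|_] //= jl.
by have := nd j; lia.
Qed.

Lemma increasing_geq d : increasing d -> forall i : 'I_k, (i <= d i)%N.
Proof.
move=> inc [i ik]; elim: i ik => // i IH ik.
by apply: leq_ltn_trans (IH (ltnW ik)) _; apply: inc.
Qed.

End TypesAndRowSpaces.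

(** * Complete lists of solutions of one type *)

Section Solutions.
Variable C : numClosedFieldType.
Variables k n : nat.
Implicit Types (A B : 'M[C]_(k, n)) (d : 'I_k -> 'I_n) (T : seq nat).

(** One matrix per solution plane. The last clause is the Frobenius formula for the number of
    standard tableaux of shape [d i - i], multiplied out to avoid a division. *)
Definition solution_list d T (L : seq 'M[C]_(k, n)) : Prop :=
  [/\ uniq L, {in L &, forall A B, (A == B)%MS -> A = B},
      (forall A, A \in L -> [/\ has_type d A, real_mx A, wr_vanishes T A & nondegenerate d T A]),
      (forall A, has_type d A -> wr_vanishes T A -> exists2 B, B \in L & (A == B)%MS)
    & ((size L)%:R * \prod_i ((d i)`!)%:R = ((size T)`!)%:R * falling_det C (fun i => d i))].

Definition generic_roots T : Prop := uniq T /\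
  forall d, increasing d -> (\sum_i d i = size T + \sum_(i < k) i)%N ->
  exists L, solution_list d T L.

Lemma wr_vanishes_mulmx T (G : 'M[C]_k) A : wr_vanishes T A -> wr_vanishes T (G *m A).
Proof. by move=> H t /H Ht; rewrite wr_mulmx hornerZ Ht mulr0. Qed.

(* Rescaling so that the largest maximal minor is 1 bounds all entries, by Cramer's rule. *)
Lemma bounded_representative A d : colsub d A \in unitmx ->
  exists (alpha : {ffun 'I_k -> 'I_n}) (G : 'M[C]_k),
  [/\ G \in unitmx, colsub alpha (G *m A) = 1%:M & forall i b, `|(G *m A) i b| <= 1].
Proof.
move=> ud; have [alpha max] := exists_max_norm [ffun i => d i]
  (fun e : {ffun 'I_k -> 'I_n} => \det (colsub e A)).
have det0 : \det (colsub alpha A) != 0.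
  rewrite -normr_gt0; apply: lt_le_trans (max [ffun i => d i]).
  rewrite normr_gt0 -unitfE -unitmxE; congr (_ \in unitmx): ud.
  by apply/matrixP => i j; rewrite !mxE ffunE.
have ua : colsub alpha A \in unitmx by rewrite unitmxE unitfE.
exists alpha, (invmx (colsub alpha A)); split; [by rewrite unitmx_inv|exact: colsub_normalized|].
move=> i b; rewrite normalized_entry // normrM normfV ler_pdivrMr ?normr_gt0 // mul1r.
have := max [ffun l => set_at alpha i b l]; congr (`|\det _| <= _).
by apply/matrixP => x y; rewrite !mxE ffunE.
Qed.

End Solutions.

(** * Adding one root *)

Section TypeFromRoots.
Variable C : numClosedFieldType.
Variables k n : nat.
Implicit Types (A : 'M[C]_(k, n)) (d : 'I_k -> 'I_n).

Lemma wr_type_neq0 d A m : increasing d -> has_type d A ->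
  (\sum_i d i = m + \sum_(i < k) i)%N -> (wr A)`_m != 0.
Proof.
move=> inc [sA nz] dm; rewrite (wr_top sA dm).2 mulf_neq0 //.
  by have inj := increasing_inj inc; apply: falling_det_neq0 => a b /val_inj/inj.
by apply/prodf_neq0 => i _; apply: nz.
Qed.

Lemma increasing_excess d : increasing d ->
  (\sum_i d i = (\sum_i d i - \sum_(i < k) i) + \sum_(i < k) i)%N.
Proof. by move=> inc; rewrite subnK //; apply: leq_sum => i _; apply: increasing_geq. Qed.

Lemma roots_le_excess d A (T : seq nat) m : increasing d -> has_type d A ->
  (\sum_i d i = m + \sum_(i < k) i)%N -> uniq T -> wr_vanishes T A -> (size T <= m)%N.
Proof.
move=> inc tA dm uT zA; have nz := wr_type_neq0 inc tA dm.
have wr0 : wr A != 0 by apply: contraNneq nz => ->; rewrite coef0.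
rewrite -(size_map (fun t => t%:R : C)) -ltnS; apply: leq_trans (wr_top tA.1 dm).1.
apply: max_poly_roots => //; first by apply/allP => _ /mapP[t tT ->]; apply/rootP/zA.
by rewrite map_inj_uniq // => a b /eqP; rewrite eqr_nat => /eqP.
Qed.

(** Let [d0] be the echelon type of [a]. The roots bound its excess from below by [size T], the
    degree of [wr a] bounds it from above. Domination by [d], whose sum is larger by one, leaves a
    single lowered place, and injectivity of [d0] makes that place a corner. *)
Lemma corner_type d a (alpha : 'I_k -> 'I_n) (T : seq nat) : increasing d ->
  (\sum_i d i = (size T).+1 + \sum_(i < k) i)%N -> uniq T ->
  colsub alpha a = 1%:M -> (size (wr a) <= (size T).+1)%N -> wr_vanishes T a ->
  (forall d', colsub d' a \in unitmx -> exists s : 'S_k, forall j, (d' (s j) <= d j)%N) ->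
  exists2 i, corner d i & exists2 G : 'M[C]_k, G \in unitmx & has_type (lower_at d i) (G *m a).
Proof.
move=> inc dm uT ua sza za dom.
have rka : \rank a = k by apply: (@colsub_unit_rank _ _ _ alpha); rewrite ua unitmx1.
have [d0 [inc0 [G uG tc]]] := exists_type rka.
have e_sum := increasing_excess inc0; set e := (_ - _)%N in e_sum.
have le_m := roots_le_excess inc0 tc e_sum uT (wr_vanishes_mulmx G za).
have le_e : (e <= size T)%N.
  rewrite leqNgt; apply/negP => lt; have := wr_type_neq0 inc0 tc e_sum.
  by rewrite wr_mulmx coefZ nth_default ?mulr0 ?eqxx // (leq_trans sza).
have {le_m le_e} eT : e = size T by apply/eqP; rewrite eqn_leq le_e.
have u0 : colsub d0 a \in unitmx.
  by have := type_colsub_unit inc0 tc; rewrite colsub_mulmx unitmx_mul => /andP[].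
have [s Hs] := dom d0 u0.
have sumE : (\sum_j d j = (\sum_j d0 (s j)).+1)%N.
  rewrite -(reindex_inj (@perm_inj _ s) (P := xpredT) (F := fun j => d0 j : nat)) /=.
  by rewrite dm e_sum eT.
have [i [di dj]] := sum_succ_corner Hs sumE.
have inj0 := increasing_inj inc0.
have low_eq : lower_at d i = d0 \o s.
  apply: funext => l; rewrite /lower_at /=; case: eqP => [->|/eqP li]; apply: val_inj => /=.
    by rewrite -di.
  by rewrite dj.
exists i.
  rewrite /corner -di /=; apply/forallP => l; rewrite di; apply/eqP => dl.
  have [li|li] := eqVneq l i; first by rewrite li in dl; lia.
  have : d0 (s l) = d0 (s i) by apply: val_inj => /=; rewrite dj //; lia.
  by move/inj0/perm_inj/eqP; rewrite (negPf li).
exists (perm_mx s *m G); first by rewrite unitmx_mul unitmx_perm.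
rewrite low_eq -mulmxA -row_permE; case: tc => st nz.
by split=> [j b jb|j]; rewrite mxE ?nz // st.
Qed.

End TypeFromRoots.

Section Step.
Variables (C : numClosedFieldType) (U : set_system nat).
Context {ultraU : UltraFilter U}.
Hypothesis complU : ultra_complete C U.
Hypothesis minC : has_approx_min C.
Hypothesis invU : ulim U (fun m => (m.+1%:R : C)^-1) 0.
Variables (k n : nat) (T : seq nat).
Hypothesis uniqT : uniq T.
Variable d : 'I_k -> 'I_n.
Hypothesis inc : increasing d.
Hypothesis d_sum : (\sum_i d i = (size T).+1 + \sum_(i < k) i)%N.

Lemma lower_excess i : corner d i -> (\sum_j lower_at d i j = size T + \sum_(j < k) j)%N.
Proof.
by move=> ci; apply/eqP; rewrite -eqSS -(lowers_sum (corner_lowers inc ci)) d_sum.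
Qed.

(** Representatives with entries at most 1 and an identity block converge to a matrix still of rank
    [k]. The last clause allows any representative [p] of the limit plane, since the listed solution
    agrees with the limit only up to row space. *)
Lemma solutions_converge (B : nat -> 'M[C]_(k, n)) :
  (\forall q \near U, has_type d (B q) /\ wr_vanishes (q.+1 :: T) (B q)) ->
  exists2 i, corner d i &
  exists c, [/\ has_type (lower_at d i) c, wr_vanishes T c &
    forall p, has_type (lower_at d i) p -> (c == p)%MS ->
    exists2 B' : nat -> 'M[C]_(k, n), mlim U B' p &
      \forall q \near U, chart_solution d (lower_at d i) T p q (B' q) /\ (B q == B' q)%MS].
Proof.
move=> solB.
have rep (q : nat) : exists y : {ffun 'I_k -> 'I_n} * 'M[C]_(k, n),
    (forall i b, `|y.2 i b| <= 1) /\ (has_type d (B q) ->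
      colsub y.1 y.2 = 1%:M /\ exists2 G : 'M[C]_k, G \in unitmx & y.2 = G *m B q).
  (* Completeness along [U] requires a bound at every [q], so the zero matrix is used where [B q]
     has another type. *)
  case: (pselect (has_type d (B q))) => [tB|ntB]; last first.
    by exists ([ffun i => d i], 0); split => // i b; rewrite mxE normr0.
  have [alpha [G [uG Ga Gb]]] := bounded_representative (type_colsub_unit inc tB).
  by exists (alpha, G *m B q); split => // _; split => //; exists G.
have [y Hy] := choice rep.
pose A q := (y q).2.
have [alpha yalpha] : exists alpha, \forall q \near U, (y q).1 = alpha.
  exact: near_const_fin.
have [a Aa] : exists a, mlim U A a by apply: (mlim_bounded complU) => q; apply: (Hy q).1.
have BA : \forall q \near U, exists2 G : 'M[C]_k, G \in unitmx & A q = G *m B q.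
  by apply: filterS solB => q [tB _]; have [_ /(_ tB) []] := Hy q.
have aalpha : colsub alpha a = 1%:M.
  apply: (@mlim_unique _ U _ _ _ (fun q => colsub alpha (A q))); first exact: mlim_colsub.
  apply: (@mlim_near _ U _ _ _ (fun=> 1%:M)); last exact: mlim_cst.
  by apply: filterS2 yalpha solB => q <- [tB _]; have [_ /(_ tB) []] := Hy q.
have wrA : plim U (fun q => wr (A q)) (wr a) by apply: plim_wr.
have A_sol : \forall q \near U, (size (wr (A q)) <= (size T).+2)%N /\ wr_vanishes (q.+1 :: T) (A q).
  apply: filterS2 solB BA => q [tB zB] [G uG ->]; split; last exact: wr_vanishes_mulmx.
  by rewrite wr_mulmx; apply: leq_trans (size_scale_leq _ _) (wr_top tB.1 d_sum).1.
have sza2 : (size (wr a) <= (size T).+2)%N.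
  apply/leq_sizeP => l lT; apply: (ulim_unique (wrA l)).
  apply: (@ulim_near _ U _ (fun=> 0)); last exact: ulim_cst.
  by apply: filterS A_sol => q [sz _]; rewrite nth_default // (leq_trans sz).
have za : wr_vanishes T a.
  move=> t tT; rewrite -(hev1 _ sza2); apply: (ulim_unique (u := fun q => hev (size T).+1 (1, t%:R) (wr (A q)))).
    by apply: (ulim_hev (st := fun=> (1, t%:R)) (st0 := (1, t%:R))) => //=; apply: ulim_cst.
  apply: (@ulim_near _ U _ (fun=> 0)); last exact: ulim_cst.
  by apply: filterS A_sol => q [sz zA]; rewrite hev1 // zA // inE tT orbT.
have sza : (size (wr a) <= (size T).+1)%N.
  apply/leq_sizeP => l; rewrite leq_eqVlt => /orP[/eqP <-|lT]; last first.
    by rewrite nth_default // (leq_trans sza2).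
  (* Divided by the power of [q.+1] of exponent [(size T).+1], the equation at the root [q.+1]
     becomes [hev] at [(1/(q+1), 1)], whose limit is the coefficient of that degree. So the degree
     drops. *)
  rewrite -hev0; apply: (ulim_unique (u := fun q => hev (size T).+1 (q.+1%:R^-1, 1) (wr (A q)))).
    by apply: (ulim_hev (st := fun q => (q.+1%:R^-1, 1)) (st0 := (0, 1))) => //=; apply: ulim_cst.
  apply: (@ulim_near _ U _ (fun=> 0)); last exact: ulim_cst.
  apply: filterS A_sol => q [sz zA].
  have q0 : q.+1%:R != 0 :> C by rewrite pnatr_eq0.
  have := zA q.+1; rewrite inE eqxx => /(_ isT); rewrite -(hev_inv q0 sz) => /eqP.
  by rewrite mulf_eq0 expf_eq0 (negPf q0) andbF => /eqP.
have unitB d' : colsub d' a \in unitmx -> \forall q \near U, colsub d' (A q) \in unitmx /\ colsub d' (B q) \in unitmx.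
  move=> ud'; have uA : \forall q \near U, colsub d' (A q) \in unitmx.
    by apply: mlim_unit ud' _; apply: mlim_colsub.
  apply: filterS2 uA BA => q uA [G uG E]; split=> //.
  by move: uA; rewrite E colsub_mulmx unitmx_mul => /andP[].
have dom d' : colsub d' a \in unitmx -> exists s : 'S_k, forall j, (d' (s j) <= d j)%N.
  move=> /unitB ud'.
  have : \forall q \near U, exists s : 'S_k, forall j, (d' (s j) <= d j)%N.
    by apply: filterS2 ud' solB => q [_ uB] [tB _]; apply: minor_dominated tB.1 uB.
  by case/filter_ex.
have [i ci [G uG tc]] := corner_type inc d_sum uniqT aalpha sza za dom.
exists i => //; exists (G *m a); split=> // [|p tp /eqmxMunitP[H uH cp]].
  exact: wr_vanishes_mulmx.
set d1 := lower_at d i in tc tp *.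
have low : lowers d i d1 := corner_lowers inc ci.
have [_ inc1] := lowers_increasing low.
have uP := type_colsub_unit inc1 tp.
have ua1 : colsub d1 a \in unitmx.
  by have := type_colsub_unit inc1 tc; rewrite colsub_mulmx unitmx_mul => /andP[].
exists (fun q => colsub d1 p *m invmx (colsub d1 (A q)) *m A q).
  have pE : colsub d1 p *m invmx (colsub d1 a) *m a = p.
    have pE : p = invmx H *m G *m a by rewrite -mulmxA cp mulKmx.
    by rewrite [in colsub d1 p]pE colsub_mulmx mulmxK // -pE.
  have : mlim U (fun q => colsub d1 p *m invmx (colsub d1 (A q)) *m A q)
      (colsub d1 p *m invmx (colsub d1 a) *m a).
    apply: mlimM => //; apply: mlimM; first exact: mlim_cst.
    by apply: mlim_inv => //; apply: mlim_colsub.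
  by rewrite pE.
apply: filterS3 (unitB _ ua1) solB (filterI BA A_sol) => q [uA uB] [tB zB] [[K uK AE] [_ zA]].
(* Normalising the pivot block cancels the change of basis between [A q] and [B q]. The form in [A]
   has a limit, the form in [B] is supported below [d]. *)
have E : colsub d1 p *m invmx (colsub d1 (A q)) *m A q =
    colsub d1 p *m invmx (colsub d1 (B q)) *m B q.
  have uKB : K *m colsub d1 (B q) \in unitmx by rewrite unitmx_mul uK.
  rewrite -!mulmxA; congr (_ *m _); rewrite AE colsub_mulmx.
  by rewrite -[RHS](mulKmx uKB) -[in RHS](mulmxA K) mulKVmx.
split; last first.
  apply/eqmxMunitP; exists (colsub d1 (B q) *m invmx (colsub d1 p)).
    by rewrite unitmx_mul uB unitmx_inv.
  by rewrite E !mulmxA mulmxKV // mulmxV // mul1mx.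
split.
- rewrite E; apply: supp_le_mulmx inc _ tB.1; apply: mulmx_trig.
    exact: trig_supp inc1 tp.1.
  by apply: invmx_trig uB; case: low => _ _ gap; apply: trig_supp gap tB.1.
- by rewrite colsub_mulmx mulmxKV.
exact: wr_vanishes_mulmx.
Qed.

(** Away from corners, either [d i = 0] or lowering [d i] creates two equal rows; so the sum over
    all [i] in [falling_det_pred_sum] runs over corners only. *)
Lemma corner_falling_det i : (d i)%:R *
    falling_det C (fun l => if l == i then (d i).-1 else d l) =
  if corner d i then (d i)%:R * falling_det C (fun l => lower_at d i l) else 0.
Proof.
case: ifP => [_|/negbT].
  by congr (_ * falling_det _ _); apply: funext => l; rewrite /lower_at; case: eqP.
rewrite negb_and -leqNgt leqn0 => /orP[/eqP ->|/forallPn[l]]; first by rewrite mul0r.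
rewrite negbK => /eqP dl; rewrite (@falling_det_eq0 _ _ _ l i) ?mulr0 //.
  by apply: contra_eq_neq dl => ->; rewrite neq_ltn ltnSn orbT.
by rewrite eqxx -dl; case: eqP.
Qed.

Lemma corner_count (c : 'I_k -> nat) :
  (forall i, corner d i -> (c i)%:R * \prod_j ((lower_at d i j)`!)%:R =
     ((size T)`!)%:R * falling_det C (fun l => lower_at d i l)) ->
  (\sum_(i | corner d i) c i)%:R * \prod_j ((d j)`!)%:R =
    ((size T).+1`!)%:R * falling_det C (fun l => d l).
Proof.
move=> Hc; rewrite natr_sum mulr_suml.
transitivity (((size T)`!)%:R * \sum_i ((d i)%:R *
    falling_det C (fun l => if l == i then (d i).-1 else d l))).
  rewrite mulr_sumr [in LHS]big_mkcond /=; apply: eq_bigr => i _.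
  rewrite corner_falling_det; case: ifP => [ci|]; last by rewrite mulr0.
  rewrite mulrCA -Hc // [RHS]mulrCA; congr (_ * _).
  rewrite (bigD1 i) //= [in RHS](bigD1 i) //= mulrA; congr (_ * _).
    by rewrite /lower_at eqxx /= -natrM; case: (val (d i)) (andP ci).1 => // a _; rewrite factS.
  by apply: eq_bigr => j /negPf ji; rewrite /lower_at ji.
have := falling_det_pred_sum C (fun i => d i : nat).
by rewrite d_sum natrD mulrDl => /addIr ->; rewrite factS natrM mulrCA mulrA.
Qed.

Lemma near_solution_list : (forall i, corner d i -> exists L, solution_list (C:=C) (lower_at d i) T L) ->
  \forall q \near U, exists L, solution_list (C:=C) d (q.+1 :: T) L.
Proof.
move=> IH.
have IH' i : exists L, corner d i -> solution_list (C:=C) (lower_at d i) T L.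
  case: (boolP (corner d i)) => [/IH[L HL]|_]; first by exists L.
  by exists [::].
have [Lf HL] := choice IH'.
pose good x (A : nat -> 'M[C]_(k, n)) := corner d x.1 -> x.2 \in Lf x.1 ->
  mlim U A x.2 /\ \forall q \near U,
    [/\ chart_solution d (lower_at d x.1) T x.2 q (A q), has_type d (A q),
        nondegenerate d (q.+1 :: T) (A q) & real_mx (A q)].
have exA x : exists A, good x A.
  case: x => i p; case: (pselect (corner d i /\ p \in Lf i)) => [[ci pL]|no]; last first.
    by exists (fun=> p) => ci pL; case: no.
  have [_ _ /(_ p pL)[tp rp zp np] _ _] := HL i ci.
  have low := corner_lowers inc ci.
  have [A Ap HA] := chart_solutions_exist complU minC invU low d_sum uniqT (erefl _) tp zp np.
  exists A => _ _; split=> //.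
  have rA : \forall q \near U, real_mx (A q).
    apply: (real_chart_solutions invU low d_sum uniqT (erefl _) tp np rp Ap).
    by apply: filterS HA => q [].
  by apply: filterS2 HA rA => q [].
have [f Hf] := choice exA.
pose Ps := [seq (i, p) | i <- enum (corner d), p <- Lf i].
have PsP x : x \in Ps -> corner d x.1 /\ x.2 \in Lf x.1.
  by case/allpairsPdep => i [p [ici pL ->]]; rewrite mem_enum in ici.
have uPs : uniq Ps.
  apply: allpairs_uniq_dep => [|i|[i p] [i' p'] _ _ /= [-> ->] //]; first exact: enum_uniq.
  by rewrite mem_enum => ci; have [] := HL i ci.
have near_all (P : nat -> 'I_k * 'M[C]_(k, n) -> Prop) :
    (forall x, x \in Ps -> \forall q \near U, P q x) ->
    \forall q \near U, forall x, x \in Ps -> P q x.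
  elim: Ps {PsP uPs} => [|x l IHl] H; first by apply: nearW.
  apply: filterS2 (H x (mem_head _ _)) (IHl _) => [q Hx Hl y|y yl].
    by rewrite inE => /orP[/eqP -> //|/Hl].
  by apply: H; rewrite inE yl orbT.
have HPs : \forall q \near U, forall x, x \in Ps ->
    [/\ chart_solution d (lower_at d x.1) T x.2 q (f x q), has_type d (f x q),
        nondegenerate d (q.+1 :: T) (f x q) & real_mx (f x q)].
  by apply: near_all => x /PsP[ci pL]; apply: (Hf x ci pL).2.
have Hdist : \forall q \near U, forall x, x \in Ps -> forall y, y \in Ps ->
    (f x q == f y q)%MS -> x = y.
  apply: (near_all _) => x xPs; apply: near_all => y yPs.
  have [[ci pL] [ci' pL']] := (PsP x xPs, PsP y yPs).
  (* If the two deformations spanned the same plane for almost all [q], so would their limits, and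
     these are listed solutions at corners that must then coincide. *)
  have [E|NE] := near_or_near_not (fun q => (f x q == f y q)%MS); last first.
    by apply: filterS NE => q.
  have [ux ix tx _ _] := HL _ ci; have [_ _ ty _ _] := HL _ ci'.
  have low := corner_lowers inc ci; have low' := corner_lowers inc ci'.
  have [[tp _ _ _] [tp' _ _ _]] := (tx _ pL, ty _ pL').
  have xy : (x.2 == y.2)%MS.
    apply: eqmx_lim (Hf x ci pL).1 (Hf y ci' pL').1 _ _ E.
      exact: type_colsub_unit (lowers_increasing low).2 tp.
    exact: type_colsub_unit (lowers_increasing low').2 tp'.
  have xy1 := lowers_row_spaces low low' tp tp' xy.
  apply: nearW => q _; case: x y xy1 xy pL pL' {xPs yPs ci ci' E ty low low' tp tp'} ux ix tx => i p [i' p'] /= <- xy pL pL' _ ix _.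
  by rewrite (ix _ _ pL pL' xy).
have Hcompl : \forall q \near U, forall A, has_type d A -> wr_vanishes (q.+1 :: T) A ->
    exists2 x, x \in Ps & (A == f x q)%MS.
  (* Otherwise almost every [q] has a missed solution [B q]. These converge to the plane of a listed
     [p], and uniqueness in the chart at [p] identifies them with [f (i, p) q]. *)
  have [//|bad] := near_or_near_not (fun q => forall A, has_type d A -> wr_vanishes (q.+1 :: T) A ->
    exists2 x, x \in Ps & (A == f x q)%MS).
  exfalso.
  pose miss q (A : 'M[C]_(k, n)) := [/\ has_type d A, wr_vanishes (q.+1 :: T) A
    & ~ exists2 x, x \in Ps & (A == f x q)%MS].
  have exB q : exists B, (exists A, miss q A) -> miss q B.
    by case: (pselect (exists A, miss q A)) => [[A mA]|no]; [exists A|exists 0].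
  have [B HB] := choice exB.
  have {HB bad} missB : \forall q \near U, miss q (B q).
    apply: filterS bad => q nall; apply: HB; apply: contrapT => none; apply: nall => A tA zA.
    by apply: contrapT => nx; apply: none; exists A.
  have [|i ci [c [tc zc Hc]]] := @solutions_converge B.
    by apply: filterS missB => q [].
  have [_ _ Lp /(_ c tc zc)[p pL cp] _] := HL i ci.
  have [tp _ zp np] := Lp p pL.
  have [B' B'p HB'] := Hc p tp cp.
  have low := corner_lowers inc ci.
  have xPs : (i, p) \in Ps by apply/allpairsPdep; exists i, p; rewrite mem_enum.
  have same : \forall q \near U, B' q = f (i, p) q.
    apply: (chart_solution_unique invU low d_sum uniqT (erefl _) tp np B'p (Hf (i, p) ci pL).1).
      by apply: filterS HB' => q [].
    by apply: filterS HPs => q /(_ _ xPs)[].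
  have : \forall q \near U, False.
    apply: filterS3 missB HB' same => q [_ _ nx] [_ eqB] E; apply: nx.
    by exists (i, p); rewrite // -E.
  by case/filter_ex.
apply: filterS3 HPs Hdist Hcompl => q Hq Dq Cq.
exists [seq f x q | x <- Ps]; split.
- rewrite map_inj_in_uniq // => x y xPs yPs E; apply: Dq => //.
  by rewrite E; apply/eqmxP.
- by move=> _ _ /mapP[x xPs ->] /mapP[y yPs ->] /(Dq _ xPs _ yPs) ->.
- by move=> _ /mapP[x /Hq[[_ _ zx] tx nx rx] ->].
- move=> A tA zA; have [x xPs Ax] := Cq A tA zA.
  by exists (f x q) => //; apply: map_f.
rewrite size_map size_allpairs_dep sumnE big_map big_enum /=.
by apply: corner_count => i ci; have [] := HL i ci.
Qed.

End Step.

(** * Existence of generic roots by induction on their number *)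

Section Existence.
Variables (C : numClosedFieldType) (U : set_system nat).
Context {ultraU : UltraFilter U}.
Hypothesis complU : ultra_complete C U.
Hypothesis minC : has_approx_min C.
Hypothesis invU : ulim U (fun m => (m.+1%:R : C)^-1) 0.
Variables (k n : nat).

(** Excess 0 forces [d i = i], and the only plane of that type consists of the polynomials of degree
    less than [k]. *)
Lemma generic_roots_nil : generic_roots C k n [::].
Proof.
split=> // d inc dsum; have did (i : 'I_k) : d i = i :> nat.
  have /= leif := leqif_sum (fun j (_ : xpredT j) => leqif_eq (increasing_geq inc j)).
  have /forallP Eq : [forall j : 'I_k, (j : nat) == d j] by rewrite -leif dsum.
  by apply/esym/eqP/Eq.
pose A0 : 'M[C]_(k, n) := \matrix_(i, b) (b == d i)%:R.
have sub B : supp_le d B -> B = colsub d B *m A0.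
  move=> sB; apply/matrixP => i b; rewrite mxE.
  have [bk|kb] := ltnP b k.
    have bd : b = d (Ordinal bk) by apply: val_inj; rewrite /= did.
    rewrite (bigD1 (Ordinal bk)) //= !mxE -bd eqxx mulr1 big1 ?addr0 // => j jb.
    rewrite !mxE bd; case: eqP => [/(increasing_inj inc)/esym/eqP|]; last by rewrite mulr0.
    by rewrite (negPf jb).
  rewrite sB; last by rewrite did (leq_trans (ltn_ord i)).
  rewrite big1 // => j _; rewrite !mxE; case: eqP => [bd|]; last by rewrite mulr0.
  by move: kb; rewrite bd did leqNgt ltn_ord.
have tA0 : has_type d A0.
  split=> [i b ib|i]; rewrite mxE ?eqxx ?oner_neq0 //.
  by case: eqP ib => // ->; rewrite ltnn.
exists [:: A0]; split => //.
- by move=> A B; rewrite !inE => /eqP -> /eqP ->.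
- move=> A; rewrite inE => /eqP ->; split=> //.
    by apply/matrixP => i b; rewrite !mxE rmorph_nat.
  by move=> B sB _; rewrite (sub B sB) submxMl.
- move=> A tA _; exists A0; rewrite ?inE //; apply/eqmxMunitP.
  by exists (colsub d A); [apply: type_colsub_unit|apply: sub tA.1].
rewrite fact0 !mul1r.
have -> : (fun i => d i : nat) = (fun i => i : nat) by apply: funext.
by rewrite falling_det_id; apply: eq_bigr => i _; rewrite did.
Qed.

(** One root has to serve every type. Encoding types as finite functions makes them a finite set, so
    almost every [q] works for all of them. *)
Lemma generic_roots_cons T : generic_roots C k n T -> exists q, generic_roots C k n (q.+1 :: T).
Proof.
case=> uT IH.
have H : \forall q \near U, forall e : {ffun 'I_k -> 'I_n}, increasing e ->
    (\sum_i e i = (size T).+1 + \sum_(i < k) i)%N ->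
    exists L, solution_list (C:=C) e (q.+1 :: T) L.
  apply: near_forall_fin => e.
  case: (pselect (increasing e /\ (\sum_i e i = (size T).+1 + \sum_(i < k) i)%N)) => [[inc es]|no].
    apply: filterS (near_solution_list complU minC invU uT inc es _) => [q HL _ _ //|i ci].
    apply: IH; first exact: (lowers_increasing (corner_lowers inc ci)).2.
    exact: (@lower_excess _ _ T).
  by apply: nearW => q inc es; case: no.
have nT : \forall q \near U, q.+1 \notin T by exact: near_new_root invU T.
have [q [Hq qT]] := filter_ex (filterI H nT).
exists q; split; first by rewrite /= qT.
move=> d inc ds; have E : d = [ffun i => d i] :> (_ -> _) by apply: funext => i; rewrite ffunE.
by rewrite E; apply: Hq; rewrite -E.
Qed.

Lemma generic_roots_exist m : exists2 T, size T = m & generic_roots C k n T.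
Proof.
elim: m => [|m [T sT gT]]; first by exists [::] => //; apply: generic_roots_nil.
by have [q gq] := generic_roots_cons gT; exists (q.+1 :: T) => //=; rewrite sT.
Qed.

End Existence.

(** * The osculating flag and the Wronskian *)

Section RowSpans.
Variables (F : fieldType) (n : nat).

(** Has the shape of [osc_flag], which is thereby an instance by conversion. *)
Definition row_span m (A : 'M[F]_(m, n)) : {vspace 'rV[F]_n} := <<[seq row a A | a : 'I_m]>>%VS.

Lemma mem_row_span m (A : 'M[F]_(m, n)) v : (v \in row_span A) = (v <= A)%MS.
Proof.
apply/idP/idP => [/coord_span ->|/submxP[c ->]].
  apply: summx_sub => i _; apply: scalemx_sub.
  have /fintype.imageP[a _ ->] : [seq row a A | a : 'I_m]`_i \in [seq row a A | a : 'I_m].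
    by apply: mem_nth; rewrite size_tuple; apply: ltn_ord.
  exact: row_sub.
rewrite mulmx_sum_row; apply: memv_suml => i _; apply: memvZ; apply: memv_span.
exact: fintype.image_f.
Qed.

Lemma row_span_eq m m' (A : 'M[F]_(m, n)) (B : 'M[F]_(m', n)) :
  (A :=: B)%MS <-> row_span A = row_span B.
Proof.
split=> [AB|E]; first by apply/vspaceP => v; rewrite !mem_row_span AB.
by apply/eqmxP/andP; split; apply/rV_subP => v; rewrite -!mem_row_span E.
Qed.

Lemma row_span_exists (K : {vspace 'rV[F]_n}) : exists A : 'M[F]_(\dim K, n), row_span A = K.
Proof.
exists (\matrix_i (vbasis K)`_i); rewrite -[RHS](span_basis (vbasisP K)).
apply/vspaceP => v; rewrite mem_row_span; apply/idP/idP => [/submxP[c ->]|/coord_span ->].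
  rewrite mulmx_sum_row; apply: memv_suml => i _; apply: memvZ; rewrite rowK.
  by apply: memv_span; apply: mem_nth; rewrite size_tuple.
apply: summx_sub => i _; apply: scalemx_sub.
by rewrite -[(vbasis K)`_i](rowK (fun j : 'I_(\dim K) => (vbasis K)`_j)) row_sub.
Qed.

Lemma dim_row_span m (A : 'M[F]_(m, n)) : \dim (row_span A) = \rank A.
Proof.
wlog fA : m A / row_free A => [IH|].
  transitivity (\dim (row_span (row_base A))).
    by congr (\dim _); apply/row_span_eq/eqmx_sym/eq_row_base.
  by rewrite IH ?row_base_free // eq_row_base.
have -> : \rank A = m by apply/eqP.
pose X := [tuple row i A | i < m].
have XE : [seq row a A | a : 'I_m] = X by rewrite /image_mem /= enumT.
have /eqP : free X.
  apply/freeP => c; under eq_bigr do rewrite -tnth_nth tnth_mktuple.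
  move=> c0 i.
  have : \row_i c i *m A = 0.
    by rewrite mulmx_sum_row -[RHS]c0; apply: eq_bigr => j _; rewrite mxE.
  move/(congr1 (mulmxr (pinvmx A)))/rowP/(_ i); rewrite /= mulmxKp // mul0mx.
  by rewrite !mxE.
by rewrite /row_span XE => ->; rewrite size_tuple.
Qed.

End RowSpans.

Section OsculatingFlag.
Variable F : numFieldType.
Variables k n : nat.

Definition osculating (t : F) : 'M[F]_(n - k, n) :=
  \matrix_(a < n - k, b < n)
     (if (a <= b)%N then ('C(b, a))%:R * t ^+ (b - a) else 0).

(* Identifies v with the polynomial sum_b v_b C(n-1,b) (-x)^(n-1-b): gamma(t) goes to (t - x)^(n-1), and F_(n-k)(t) to the polynomials vanishing to order k at t. *)
Definition apolar : 'M[F]_n :=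
  \matrix_(b, c) ((c == rev_ord b)%:R * ('C(n.-1, b))%:R * (-1) ^+ (n.-1 - b)).

Definition wr_at (t : F) : 'M[F]_(n, k) := map_mx (horner_eval t) (wr_mx F k n).

Lemma wr_horner (A : 'M[F]_(k, n)) t : (wr A).[t] = \det (A *m wr_at t).
Proof.
rewrite -[LHS]/(horner_eval t (wr A)) /wr -det_map_mx /lift_wr map_mxM.
congr (\det (_ *m _)); apply/matrixP => i j; rewrite !mxE /= /horner_eval.
by rewrite hornerC.
Qed.

Lemma mul_apolar m (A : 'M[F]_(m, n)) i c : (A *m apolar) i c =
  A i (rev_ord c) * (('C(n.-1, rev_ord c))%:R * (-1) ^+ (n.-1 - rev_ord c)).
Proof.
rewrite mxE (bigD1 (rev_ord c)) //= !mxE rev_ordK eqxx mul1r big1 ?addr0 // => b bc.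
rewrite mxE; case: eqP => [E|]; last by rewrite !mul0r mulr0.
by case/eqP: bc; rewrite E rev_ordK.
Qed.

Lemma apolar_unit : apolar \in unitmx.
Proof.
rewrite unitmxE unitfE; apply/det0P => -[v v0 v_ap]; case/eqP: v0.
apply/rowP => b; have := mul_apolar v 0 (rev_ord b); rewrite v_ap !mxE rev_ordK => /esym/eqP.
rewrite !mulf_eq0 signr_eq0 orbF pnatr_eq0 -leqn0 leqNgt bin_gt0.
have -> : (b <= n.-1)%N by have := ltn_ord b; lia.
by rewrite orbF => /eqP.
Qed.

(** Both sides are N! / (b! (N-b-j)!) when [b + j <= N], and 0 otherwise. *)
Lemma bin_ffact_swap N b j : ('C(N, b) * (N - b) ^_ j = N ^_ j * 'C(N - j, b))%N.
Proof.
elim: j => [|j IH]; first by rewrite !ffactn0 muln1 mul1n subn0.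
rewrite !ffactnSr mulnA IH -!mulnA; congr (_ * _)%N.
have -> : (N - b - j = N - j - b)%N by lia.
by rewrite mulnC -mul_bin_down subnS.
Qed.

(** Row [a] of the osculating matrix lists the coefficients of ['X^a] in the powers of ['X + t].
    Expanding ['X^(N - j)] with 'X = -t + ('X + t) shows that the product is, up to a scalar, the
    coefficient of ['X^a] in ['X^(N - j)], and [a < N - j]. *)
Lemma osculating_annihilated t : osculating t *m apolar *m wr_at t = 0.
Proof.
apply/matrixP => a j; rewrite [RHS]mxE.
pose N := n.-1; have nN : n = N.+1 by have := ltn_ord a; rewrite /N; lia.
have aj : (a < N - j)%N by have := ltn_ord a; have := ltn_ord j; rewrite /N; lia.
have oscE (b : nat) : (if (a <= b)%N then ('C(b, a))%:R * t ^+ (b - a) else 0) =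
    (('X + t%:P) ^+ b)`_a.
  rewrite addrC exprDn coef_sum; case: leqP => ab.
    have ab' : (a < b.+1)%N by [].
    rewrite (bigD1 (Ordinal ab')) //= -polyC_exp coefMn coefCM coefXn eqxx mulr1.
    rewrite big1 ?addr0 ?mulr_natl // => l la.
    by rewrite -polyC_exp coefMn coefCM coefXn eq_sym -(inj_eq val_inj) /= in la *; rewrite (negPf la) mulr0 mul0rn.
  rewrite big1 // => l _; rewrite -polyC_exp coefMn coefCM coefXn.
  have -> : (a == l :> nat) = false by have := ltn_ord l; lia.
  by rewrite mulr0 mul0rn.
transitivity ((\sum_(b < N.+1) ((N ^_ j * 'C(N - j, b))%:R * (-1) ^+ (N - b) * t ^+ (N - b - j)) *:
    ('X + t%:P) ^+ b)`_a).
  rewrite mxE coef_sum -nN (reindex_inj rev_ord_inj) /=; apply: eq_bigr => b _.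
  rewrite mul_apolar rev_ordK !mxE /horner_eval hornerMn hornerXn coefZ -oscE.
  have -> : rev_ord b = (N - b)%N :> nat by rewrite /=; lia.
  by rewrite -bin_ffact_swap natrM -mulr_natr -/N; ring.
have -> : \sum_(b < N.+1) ((N ^_ j * 'C(N - j, b))%:R * (-1) ^+ (N - b) * t ^+ (N - b - j)) *:
    ('X + t%:P) ^+ b = ((N ^_ j)%:R * (-1) ^+ j) *: 'X^(N - j).
  have le : ((N - j).+1 <= N.+1)%N by rewrite ltnS leq_subr.
  have -> : 'X^(N - j) = (- t%:P + ('X + t%:P)) ^+ (N - j) by rewrite addrC addrK.
  rewrite exprDn scaler_sumr (big_ord_widen _ (fun b => ((N ^_ j)%:R * (-1) ^+ j) *:
    ((- t%:P) ^+ (N - j - b) * ('X + t%:P) ^+ b *+ 'C(N - j, b))) le) [RHS]big_mkcond /=.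
  apply: eq_bigr => b _; case: ifP => [bN|/negbT]; last first.
    by rewrite -leqNgt => bN; rewrite bin_small // muln0 !mul0r scale0r.
  rewrite -polyCN -polyC_exp mul_polyC -[_ *+ 'C(_, _)]scaler_nat !scalerA; congr (_ *: _).
  have -> : (N - b = (N - j - b) + j)%N by lia.
  rewrite addnK exprD natrM [(- t) ^+ _]exprNn.
  by ring.
rewrite coefZ coefXn.
have -> : (a == N - j :> nat)%N = false by lia. exact: mulr0.
Qed.

Lemma osculating_rank t : \rank (osculating t) = (n - k)%N.
Proof.
apply: (@colsub_unit_rank _ _ _ (widen_ord (leq_subr k n))).
rewrite -unitmx_tr unitmxE unitfE det_trig; last first.
  by apply/is_trig_mxP => i j ij; rewrite !mxE /= leqNgt ij.
by apply/prodf_neq0 => i _; rewrite !mxE /= leqnn subnn binn mulr1 oner_neq0.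
Qed.

Lemma wr_at_rank t : (k <= n)%N -> \rank (wr_at t) = k.
Proof.
move=> kn; rewrite -mxrank_tr.
apply: (@colsub_unit_rank _ _ _ (widen_ord kn)).
rewrite -unitmx_tr unitmxE unitfE det_trig; last first.
  apply/is_trig_mxP => i j ij; rewrite !mxE /horner_eval /=.
  by rewrite ffact_small // mulr0n horner0.
apply/prodf_neq0 => i _; rewrite !mxE /horner_eval /= subnn expr0 ffactnn.
by rewrite hornerMn hornerC pnatr_eq0 -lt0n fact_gt0.
Qed.

Lemma osculating_kernel t : (k <= n)%N -> (osculating t *m apolar :=: kermx (wr_at t))%MS.
Proof.
move=> kn; apply/eqmxP; have le : (osculating t *m apolar <= kermx (wr_at t))%MS.
  by apply/sub_kermxP; apply: osculating_annihilated.
rewrite -(mxrank_leqif_eq le) mxrankMfree ?osculating_rank ?mxrank_ker ?wr_at_rank //.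
by rewrite row_free_unit apolar_unit.
Qed.

(** The osculating space is the kernel of [v *m apolar *m wr_at t]. A common vector [c *m A] is thus
    a left kernel vector [c] of a square matrix whose determinant is the Wronskian at [t]. *)
Lemma meets_osculating (A : 'M[F]_(k, n)) t : (k <= n)%N -> \rank A = k ->
  (exists2 v : 'rV_n, v != 0 & (v <= A)%MS && (v <= osculating t)%MS) <->
  (wr (A *m apolar)).[t] = 0.
Proof.
move=> kn rA; have ker v : (v <= osculating t)%MS = (v *m apolar *m wr_at t == 0).
  rewrite -(submxMfree v (osculating t) (_ : row_free apolar)) ?row_free_unit ?apolar_unit //.
  by rewrite osculating_kernel // sub_kermx.
rewrite wr_horner; split=> [[v v0 /andP[/submxP[c vc]]]|/eqP/det0P[c c0 cA]].
  rewrite ker vc => /eqP cA; apply/eqP/det0P; exists c; last by rewrite !mulmxA.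
  by apply: contra_neq v0 => c0; rewrite vc c0 mul0mx.
exists (c *m A); last by rewrite submxMl ker; rewrite !mulmxA in cA; rewrite cA eqxx.
apply: contra_neq c0 => cA0; apply/eqP.
by rewrite -(mulmx_free_eq0 c (_ : row_free A)) ?cA0 // /row_free rA.
Qed.

End OsculatingFlag.

(** * The complex numbers *)

Section ComplexLimits.
Variable R : realType.
Variable U : set_system nat.
Context {ultraU : UltraFilter U}.

(** The limit is the supremum of the numbers that lie below [u] almost everywhere; a larger number
    fails to, hence lies above [u] almost everywhere. *)
Lemma real_ultra_lim (u : nat -> R) M : (forall m, `|u m| <= M) ->
  exists l, forall e, 0 < e -> \forall m \near U, `|u m - l| < e.
Proof.
move=> uM; pose E : set R := [set x | \forall m \near U, x <= u m]%classic.
have supE : has_sup E.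
  split; first by exists (- M); apply: nearW => m; move: (uM m); rewrite ler_norml => /andP[].
  exists M => x /filter_ex[m xm]; apply: le_trans xm _.
  by move: (uM m); rewrite ler_norml => /andP[].
exists (sup E) => e e0.
have [x xE lx] := sup_adherent e0 supE.
have up : \forall m \near U, ~ (sup E + e / 2 <= u m).
  have [H|//] := near_or_near_not (fun m => sup E + e / 2 <= u m).
  by have := ub_le_sup supE.2 H; rewrite gerDl; lra.
apply: filterS2 xE up => m xm /negP; rewrite -ltNge => um.
by rewrite ltr_norml; apply/andP; split; lra.
Qed.

Lemma Re_le_norm (z : R[i]) : `|complex.Re z| <= complex.Re `|z|.
Proof. by rewrite normc_def /= -sqrtr_sqr ler_wsqrtr // lerDl sqr_ge0. Qed.

Lemma Im_le_norm (z : R[i]) : `|complex.Im z| <= complex.Re `|z|.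
Proof. by rewrite normc_def /= -sqrtr_sqr ler_wsqrtr // lerDr sqr_ge0. Qed.

Lemma norm_le_ReIm (z : R[i]) : complex.Re `|z| <= `|complex.Re z| + `|complex.Im z|.
Proof.
rewrite normc_def /=; have s0 : 0 <= `|complex.Re z| + `|complex.Im z| by rewrite addr_ge0.
rewrite -(ger0_norm s0) -sqrtr_sqr ler_wsqrtr // sqrrD !real_normK ?num_real //.
by rewrite addrAC lerDl mulrn_wge0 // mulr_ge0.
Qed.

Lemma ultra_complete_complex : ultra_complete (R[i] : numClosedFieldType) U.
Proof.
move=> u M uM.
have uM' m : complex.Re `|u m| <= complex.Re M by have := uM m; rewrite lecE => /andP[].
have [a Ha] := real_ultra_lim (fun m => le_trans (Re_le_norm _) (uM' m)).
have [b Hb] := real_ultra_lim (fun m => le_trans (Im_le_norm _) (uM' m)).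
exists (Complex a b); apply/ulimP => e; rewrite ltcE => /andP[/eqP /= ie re].
have re2 : 0 < complex.Re e / 2 by lra.
apply: filterS2 (Ha _ re2) (Hb _ re2) => m am bm; rewrite ltcE; apply/andP; split.
  by rewrite ie normc_def.
apply: le_lt_trans (norm_le_ReIm _) _.
by move: am bm; case: (u m) => x y /=; lra.
Qed.

Lemma approx_min_complex : has_approx_min (R[i] : numClosedFieldType).
Proof.
move=> P [x0 Px0] P0 e; rewrite ltcE => /andP[/eqP /= ie re].
pose E : set R := [set r | exists2 x, P x & complex.Re x = r]%classic.
have lbE : has_lbound E.
  by exists 0 => _ [x Px <-]; have := P0 x Px; rewrite lecE => /andP[].
have infE : has_inf E by split => //; exists (complex.Re x0), x0.
have [_ [x Px <-] xlt] := inf_adherent re infE.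
exists x => // y Py; rewrite lecE; apply/andP; split.
  have := P0 x Px; have := P0 y Py; rewrite !lecE => /andP[/eqP /= iy _] /andP[/eqP /= ix _].
  by move: iy ix ie; case: (y) => ? ?; case: (e) => ? ?; case: (x) => ? ? /= -> -> ->; rewrite addr0.
have : inf E <= complex.Re y by apply: ge_inf => //; exists y.
by move: xlt; case: (y) => ? ?; case: (e) => ? ?; case: (x) => ? ? /=; lra.
Qed.

Lemma ulim_inv_succ : (\oo `<=` U)%classic ->
  ulim U (fun m => (m.+1%:R : (R[i] : numClosedFieldType))^-1) 0.
Proof.
move=> ooU; apply/ulimP => e e0; apply: ooU.
have re : 0 < complex.Re e by move: e0; rewrite ltcE => /andP[].
have [N] := ltr_add_invr re; rewrite add0r => Ne.
exists N => // m /= Nm; rewrite subr0 ger0_norm ?invr_ge0 ?ler0n //.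
apply: (@le_lt_trans _ _ (N.+1%:R^-1)).
  by rewrite lef_pV2 ?posrE ?ltr0n // ler_nat.
have -> : (N.+1%:R : R[i])^-1 = ((N.+1%:R)^-1)%:C%C by rewrite fmorphV rmorph_nat.
by move: e0; rewrite !ltcE /= => /andP[-> _].
Qed.

End ComplexLimits.

Lemma real_generic_roots (k n m : nat) :
  exists2 T, size T = m & generic_roots (complex Rdefinitions.R) k n T.
Proof.
have [U [ultraU ooU]] := ultraFilterLemma eventually_filter.
apply: (@generic_roots_exist _ U) => //.
- exact: ultra_complete_complex.
- exact: approx_min_complex.
exact: ulim_inv_succ.
Qed.

(** * From solution matrices to real subspaces *)

Lemma real_mx_mulmx (C : numClosedFieldType) p q r (A : 'M[C]_(p, q)) (B : 'M[C]_(q, r)) :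
  real_mx A -> real_mx B -> real_mx (A *m B).
Proof. by move=> rA rB; rewrite /real_mx /conj_mx map_mxM -/(conj_mx A) -/(conj_mx B) rA rB. Qed.

Lemma real_apolar (C : numClosedFieldType) n : real_mx (apolar C n).
Proof. by apply/matrixP => i j; rewrite !mxE !rmorphM !rmorph_nat rmorph_sign. Qed.

Lemma real_row_span n m (A : 'M[Cx]_(m, n)) :
  real_mx (A : 'M[(complex Rdefinitions.R : numClosedFieldType)]_(m, n)) ->
  real_subspace (row_span A).
Proof.
move=> rA; exists [seq row i (map_mx (@complex.Re Rdefinitions.R) A) | i : 'I_m].
rewrite /row_span; congr (<<_>>)%VS; rewrite /image_mem -map_comp; apply: eq_map => i.
apply/rowP => j; rewrite !mxE /=; apply/esym/RRe_real.
by apply/CrealP; move/matrixP/(_ i j): rA; rewrite mxE.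
Qed.

Lemma capv_neq0 (F : fieldType) (V : vectType F) (K L : {vspace V}) :
  (K :&: L)%VS != 0%VS <-> exists2 v, v != 0 & (v \in K) && (v \in L).
Proof.
split=> [H|[v v0 vKL]].
  by exists (vpick (K :&: L)); rewrite ?vpick0 // -memv_cap memv_pick.
by apply: contraNneq v0 => H; rewrite -memv0 -H memv_cap.
Qed.

Lemma max_excess_unique k n (d : 'I_k -> 'I_n) : (k <= n)%N -> increasing d ->
  (k * (n - k) + \sum_(i < k) i <= \sum_i d i)%N -> forall i, d i = (n - k + i)%N :> nat.
Proof.
move=> kn inc; have le (i : 'I_k) : (d i <= n - k + i)%N.
  (* Downward induction, [c] being the distance from the last index. *)
  have H c : (c < k)%N -> forall j : 'I_k, (j = k.-1 - c :> nat)%N -> (d j + c < n)%N.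
    elim: c => [|c IH] ck j jc; first by rewrite addn0.
    have jk : (j.+1 < k)%N by lia.
    have jc' : (j.+1 = k.-1 - c)%N by lia.
    have := inc j (Ordinal jk) (ltnSn j); have := IH (ltnW ck) (Ordinal jk) jc'.
    lia.
  have := H (k.-1 - i)%N _ i _; have := ltn_ord i; lia.
have E : (\sum_(i < k) (n - k + i) = k * (n - k) + \sum_(i < k) i)%N.
  by rewrite big_split /= sum_nat_const card_ord.
rewrite -E => ge i.
have /= leif := leqif_sum (fun j (_ : xpredT j) => leqif_eq (le j)).
have /forallP Eq : [forall j : 'I_k, (d j : nat) == (n - k + j)%N].
  by rewrite -leif eqn_leq ge andbT; apply: leq_sum => j _; apply: le.
exact/eqP/Eq.
Qed.

Theorem mainTheorem6 (n k : nat) (hk : (0 < k)%N) (hkn : (k < n)%N) :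
  exists t : 'I_(k * (n - k)) -> R,
    exists s : seq {vspace 'rV[Cx]_n},
      [/\ uniq s,
          size s = dGr k n,
          (forall K : {vspace 'rV[Cx]_n},
             K \in s <->
             (\dim K = k /\
              forall i : 'I_(k * (n - k)),
                (K :&: osc_flag n (n - k) ((t i)%:C)%C)%VS != 0%VS))
        & (forall K, K \in s -> real_subspace K)].
Proof.
pose C : numClosedFieldType := complex R.
have [T sT [uT gT]] := real_generic_roots k n (k * (n - k)).
have topP (i : 'I_k) : (n - k + i < n)%N by have := ltn_ord i; lia.
pose top (i : 'I_k) : 'I_n := Ordinal (topP i).
have inc_top : increasing top by move=> i j ij; rewrite /= ltn_add2l.
have sum_top : (\sum_i top i = size T + \sum_(i < k) i)%N.
  by rewrite sT big_split /= sum_nat_const card_ord.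
have [L [uL iL pL cL nL]] := gT top inc_top sum_top.
pose Ap : 'M[C]_n := apolar C n.
have uAp : Ap \in unitmx := apolar_unit C n.
(* The list [L] consists of spaces of polynomials; undoing apolarity returns them to the coordinates
   of the flag. *)
pose sp (A : 'M[C]_(k, n)) : {vspace 'rV[Cx]_n} := row_span (A *m invmx Ap).
pose t (i : 'I_(k * (n - k))) : R := (nth 0%N T i)%:R.
have tE i : ((t i)%:C)%C = (nth 0%N T i)%:R :> C by rewrite /t rmorph_nat.
have meets (B : 'M[C]_(k, n)) : \rank B = k ->
    (forall i, ((row_span B : {vspace 'rV[Cx]_n}) :&: osc_flag n (n - k) ((t i)%:C)%C)%VS != 0%VS) <->
    wr_vanishes T (B *m Ap).
  move=> rB; have one i : ((row_span B : {vspace 'rV[Cx]_n}) :&: osc_flag n (n - k) ((t i)%:C)%C)%VS != 0%VS <->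
      (wr (B *m Ap)).[(nth 0%N T i)%:R] = 0.
    apply: iff_trans (capv_neq0 _ _) _; rewrite tE.
    apply: iff_trans _ (meets_osculating _ (ltnW hkn) rB).
    have E v : (v \in osc_flag n (n - k) ((nth 0%N T i)%:R : C)) =
        (v <= osculating k n ((nth 0%N T i)%:R : C))%MS := mem_row_span _ _.
    have EB v : (v \in (row_span B : {vspace 'rV[Cx]_n})) = (v <= B)%MS := mem_row_span _ _.
    split=> -[v v0 /andP[vB vO]]; exists v => //; apply/andP; split.
    - exact: etrans (esym (EB v)) vB.
    - exact: etrans (esym (E v)) vO.
    - exact: etrans (EB v) vB.
    exact: etrans (E v) vO.
  split=> [H x xT|H i].
    have xi : (index x T < k * (n - k))%N by rewrite -sT index_mem.
    by have /one := H (Ordinal xi); rewrite /= nth_index.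
  by apply/one/H/mem_nth; rewrite sT.
have spE A B : sp A = sp B -> (A == B)%MS.
  move/row_span_eq => E; apply/eqmxP.
  by rewrite -(mulmxKV uAp A) -(mulmxKV uAp B); apply: eqmxMr.
have spE' A B : (A == B)%MS -> sp A = sp B.
  by move/eqmxP=> E; apply/row_span_eq/eqmxMr.
have rank_sp A : has_type top A -> \rank (A *m invmx Ap) = k.
  move=> tA; rewrite mxrankMfree ?row_free_unit ?unitmx_inv //.
  exact: colsub_unit_rank (type_colsub_unit inc_top tA).
exists t, [seq sp A | A <- L]; split.
- by rewrite map_inj_in_uniq // => A B AL BL /spE; apply: iL.
- rewrite size_map /dGr; move: nL; rewrite sT falling_det_shift -!natr_prod -!natrM.
  move/eqP; rewrite eqr_nat => /eqP nL.
  (* The count in [nL] exhibits the numerator of [dGr] as [size L] times its denominator, so the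
     division is exact. *)
  by rewrite mulnC -nL mulnK // prodn_gt0 // => i; apply: fact_gt0.
- move=> K; split=> [/mapP[A AL ->]|[dK HK]].
    have [tA _ zA _] := pL A AL; rewrite dim_row_span rank_sp //; split=> //.
    by apply/meets; rewrite ?rank_sp // mulmxKV.
  have [B0 KB] := row_span_exists K; move: B0 KB; rewrite dK => B KB.
  have rB : \rank (B : 'M[C]_(k, n)) = k.
    exact: etrans (esym (dim_row_span B)) (etrans (congr1 (fun V => \dim V) KB) dK).
  have zB : wr_vanishes T (B *m Ap) by apply/meets => // i; rewrite KB.
  have [d [inc [G uG tG]]] : exists d, increasing d /\ exists2 G : 'M[C]_k, G \in unitmx & has_type d (G *m (B *m Ap)).
    by apply: exists_type; rewrite mxrankMfree ?row_free_unit.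
  have zG := wr_vanishes_mulmx G zB.
  (* The type of an arbitrary solution is not known in advance: k(n-k) distinct roots force the
     maximal excess, which only [top] attains. *)
  have := roots_le_excess inc tG (increasing_excess inc) uT zG; rewrite sT => le.
  have dtop : d = top.
    apply: funext => i; apply: val_inj; apply: (max_excess_unique (ltnW hkn) inc).
    by rewrite [leqRHS](increasing_excess inc) leq_add2r.
  rewrite dtop in tG; have [A AL GA] := cL _ tG zG.
  apply/mapP; exists A => //; rewrite -KB -(spE' _ _ GA).
  apply/row_span_eq.
  by apply/eqmx_sym/eqmxP/eqmxMunitP; exists G; rewrite ?mulmxA ?mulmxK.
move=> K /mapP[A /pL[_ rA _ _] ->]; apply: real_row_span.
apply: real_mx_mulmx rA _; rewrite /real_mx /conj_mx map_invmx.
by congr invmx; apply: real_apolar.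
Qed.
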